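(* Assume $X_n\to\infty$, $\mathbb{P}$-a.s. Then for $P$-a.e. $\omega$ and every $i\le 0$, the offspring mean matrix of the $(-i+1)$-th generation of the multitype branching process $(U(i))_{i\le0}$ is $$N(i)=\begin{pmatrix}\frac{\alpha(i)}{1-\alpha(i)-\beta(i)} & \frac{\beta(i)}{1-\alpha(i)-\beta(i)} & 0\\ \frac{\alpha(i)}{1-\alpha(i)-\beta(i)} & \frac{\beta(i)}{1-\alpha(i)-\beta(i)} & 1\\ \frac{\alpha(i)}{1-\alpha(i)-\beta(i)} & \frac{\beta(i)}{1-\alpha(i)-\beta(i)} & 0\end{pmatrix}.$$ Moreover, $$E_\omega(T_1)=1+\Big\langle(2,2,1),\ \frac{1}{1-\alpha(0)-\beta(0)}\big(p_1(0),\gamma(0),p_2(0)\big)\cdot\sum_{i\le 0}N(0)N(-1)\cdots N(i)\Big\rangle.$$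
   Context: **The $(1,2)$-random walk in random environment.** Let $\Lambda=\{-1,1,2\}$ and let $\mathcal{M}(\Lambda)$ be the set of probability measures on $\Lambda$. An environment is an element $\omega=\{(q(\omega)_x,p_1(\omega)_x,p_2(\omega)_x):x\in\mathbb{Z}\}\in\Omega:=\mathcal{M}(\Lambda)^{\mathbb{Z}}$ (so $q(\omega)_x+p_1(\omega)_x+p_2(\omega)_x=1$). Write $q(x)=q(\omega)_x$, $p_z(x)=p_z(\omega)_x$. Let $\theta$ be the spatial shift, $(\theta\omega)_n=\omega_{n+1}$, which is invertible and measurable together with its inverse. $P$ is a probability measure on $(\Omega,\mathcal{F})$, stationary and ergodic under $\theta$. Ellipticity is assumed: there is $\varepsilon>0$ with $p_z(0)/q(0)\ge\varepsilon$, $P$-a.s., for $z\in\{1,2\}$. Given $\omega$, $\{X_n\}_{n\ge0}$ is under $P_\omega$ (expectation $E_\omega$) the time-homogeneous Markov chain on $\mathbb{Z}$ with $X_0=0$ and $P_\omega(X_{n+1}=x-1|X_n=x)=q(x)$, $P_\omega(X_{n+1}=x+z|X_n=x)=p_z(x)$, $z\in\{1,2\}$. $P_\omega^k$ is the law of the chain started at $k$. $\mathbb{P}=P\otimes P_\omega$ is the annealed law. **Exit probabilities and $\alpha,\beta,\gamma$.** For $k\in\mathbb{Z}$ and $j=1,2$, $P_\omega^{k}[(-\infty,k),k+j]$ is the $P_\omega^k$-probability that the walk reaches $[k+1,\infty)$ for the first time at $k+j$. Define $\gamma(i)=q(i)P_\omega^{i-1}[(-\infty,i-1),i+1]$, $\alpha(i)=q(i)P_\omega^{i-1}[(-\infty,i-1),i]\frac{p_1(i-1)}{p_1(i-1)+\gamma(i-1)}$,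 $\beta(i)=q(i)P_\omega^{i-1}[(-\infty,i-1),i]\frac{\gamma(i-1)}{p_1(i-1)+\gamma(i-1)}$. **Ladder time and branching process.** $T_1=\inf\{n>0:X_n>0\}$. For $i\le 0$, each step of the walk from $i$ to $i-1$ before time $T_1$ is classified by the jump by which the walk first returns to $[i,\infty)$ afterwards (its ''crossing-back''). $A(i)$, $B(i)$, $C(i)$ are the numbers of steps from $i$ to $i-1$ before $T_1$ whose crossing-back is, respectively, from $i-1$ to $i$, from $i-2$ to $i$, and from $i-1$ to $i+1$, and $U(i)=[A(i),B(i),C(i)]$. By convention $U(1)=[1,0,0]$, $[0,1,0]$ or $[0,0,1]$ according to whether the last jump, at time $T_1$, is from $0$ to $1$, from $-1$ to $1$, or from $0$ to $2$. Under $P_\omega$, $(U(i))_{i\le0}$ is an inhomogeneous multitype (three-type) branching process started from the single immigrant particle $U(1)$, $U(i)$ being the $(-i+1)$-th generation: given $U(i+1)$, $U(i)$ is the sum of independent offspring vectors of the particles of $U(i+1)$, the offspring vector of a type-$k$ particle having the conditional law of $U(i)$ given that $U(i+1)$ is the $k$-th unit vector. The offspring mean matrix of the $(-i+1)$-th generation has $(k,l)$ entry equal to the expected number of type-$l$ particles of $U(i)$ produced by one type-$k$ particle of $U(i+1)$. Row vectors are multiplied by matrices on the right; $\langle\cdot,\cdot\rangle$ is the Euclidean inner product. *)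

(* Defs.v *)
From HB Require Import structures.
From mathcomp Require Import all_boot all_order all_algebra.
From mathcomp Require Import all_classical all_reals all_analysis.
Set Implicit Arguments.
Unset Strict Implicit.
Unset Printing Implicit Defensive.
Import Order.TTheory GRing.Theory Num.Theory.
Import numFieldNormedType.Exports.
Local Open Scope classical_set_scope.
Local Open Scope ring_scope.

(* A probability measure on {-1, 1, 2}: jq, jp1, jp2 are the masses of
   -1, 1, 2 respectively. *)
Record jump_law (R : realType) := JumpLaw {
  jq : R ;
  jp1 : R ;
  jp2 : R ;
  jq_ge0 : 0 <= jq ;
  jp1_ge0 : 0 <= jp1 ;
  jp2_ge0 : 0 <= jp2 ;
  jsum1 : jq + jp1 + jp2 = 1 }.

Section jump_law_instances.
Variable R : realType.

HB.instance Definition _ := gen_eqMixin (jump_law R).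
HB.instance Definition _ := gen_choiceMixin (jump_law R).

Fact jump_law_point_sum : 1 + 0 + 0 = 1 :> R.
Proof. by rewrite !addr0. Qed.

HB.instance Definition _ := isPointed.Build (jump_law R)
  (JumpLaw ler01 (lexx 0) (lexx 0) jump_law_point_sum).

End jump_law_instances.

HB.instance Definition _ := isPointed.Build int 0.

Section environments.
Variable R : realType.

(* The product sigma-algebra on M({-1,1,2})^Z, each factor carrying the
   sigma-algebra generated by its three masses. *)
Definition env_cylinders : set (set (int -> jump_law R)) :=
  [set A | exists (z : int) (B : set R), measurable B /\
    (A = [set w | jq (w z) \in B] \/ A = [set w | jp1 (w z) \in B] \/
     A = [set w | jp2 (w z) \in B])].

Definition env := g_sigma_algebraType env_cylinders.
HB.instance Definition _ := Measurable.on env.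

Definition shift (w : env) : env := fun n => w (n + 1).

Definition stationary (P : probability env R) : Prop :=
  forall A : set env, measurable A -> P (shift @^-1` A) = P A.

Definition ergodic (P : probability env R) : Prop :=
  forall A : set env, measurable A -> shift @^-1` A = A ->
    P A = 0%E \/ P A = 1%E.

End environments.

Definition path_cylinders : set (set (nat -> int)) :=
  [set A | exists (n : nat) (k : int), A = [set x | x n = k]].

(* Trajectories; the walk (X_n) is the coordinate process x |-> x n. *)
Definition paths := g_sigma_algebraType path_cylinders.
HB.instance Definition _ := Measurable.on paths.

Section quenched.
Variable R : realType.
Implicit Types (w : env R) (x : paths).

Definition trans w (a b : int) : R :=
  if b == a - 1 then jq (w a)
  else if b == a + 1 then jp1 (w a)
  else if b == a + 2 then jp2 (w a)
  else 0.

(* Q is the law of the time-homogeneous Markov chain with transition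
   probabilities trans w started at k.  The multiplicative form of the Markov
   property avoids conditioning on null events; these equations determine Q,
   and such a Q exists for every w and k (Ionescu-Tulcea). *)
Definition is_walk_law w (k : int) (Q : probability paths R) : Prop :=
  Q [set x : paths | x 0%N = k] = 1%E /\
  forall (n : nat) (c : nat -> int),
    Q [set x : paths | forall m, (m <= n.+1)%N -> x m = c m] =
    (Q [set x : paths | forall m, (m <= n)%N -> x m = c m] *
      (trans w (c n) (c n.+1))%:E)%E.

(* The quenched laws: Pw w k stands for P_w^k, and Pw w 0 for P_w. *)
Definition is_quenched (Pw : env R -> int -> probability paths R) : Prop :=
  forall w k, is_walk_law w k (Pw w k).

Variable Pw : env R -> int -> probability paths R.

(* P (x) P_w on environments times trajectories. *)
Definition annealed (P : probability (env R) R) (A : set (env R * paths)) :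
    \bar R :=
  (\int[P]_w Pw w 0%R (xsection A w))%E.

Definition walk_to_pinfty (x : paths) : Prop :=
  (fun n => (x n)%:~R : R) @ \oo --> +oo.

(* P_w^k[(-oo, k), k + j] *)
Definition exit_prob w (k j : int) : R :=
  fine (Pw w k [set x : paths | exists n, x n = k + j /\
                                 forall m, (m < n)%N -> x m < k + 1]).

Definition gamma w (i : int) : R := jq (w i) * exit_prob w (i - 1) 2.

Definition alpha w (i : int) : R :=
  jq (w i) * exit_prob w (i - 1) 1 *
  (jp1 (w (i - 1)) / (jp1 (w (i - 1)) + gamma w (i - 1))).

Definition beta w (i : int) : R :=
  jq (w i) * exit_prob w (i - 1) 1 *
  (gamma w (i - 1) / (jp1 (w (i - 1)) + gamma w (i - 1))).

End quenched.

Definition row3 {T : Type} (a b c : T) : 'rV[T]_3 :=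
  \row_k tnth [tuple a; b; c] k.

Section branching.
Variable R : realType.
Implicit Type x : paths.

(* +oo when the walk never becomes positive *)
Definition T1 x : \bar R :=
  ereal_inf [set n%:R%:E | n in [set n : nat | (0 < n)%N /\ 0 < x n]].

(* Time n starts a step from i to i - 1 made before T1, and the first return
   to [i, +oo) afterwards is made by a jump from a to b, at time m + 1. *)
Definition crossing_step x (i a b : int) (n : nat) : Prop :=
  (n%:R%:E < T1 x)%E /\ x n = i /\ x n.+1 = i - 1 /\
  exists m, (n < m)%N /\ (forall j, (n < j <= m)%N -> x j < i) /\
            i <= x m.+1 /\ x m = a /\ x m.+1 = b.

Definition cntA x (i : int) : \bar R :=
  counting [set n | crossing_step x i (i - 1) i n].
Definition cntB x (i : int) : \bar R :=
  counting [set n | crossing_step x i (i - 2) i n].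
Definition cntC x (i : int) : \bar R :=
  counting [set n | crossing_step x i (i - 1) (i + 1) n].

(* The last jump, made at time T1, is from a to b. *)
Definition last_jump x (a b : int) : Prop :=
  exists n : nat, T1 x = n.+1%:R%:E /\ x n = a /\ x n.+1 = b.

(* U(i) is only meaningful for i <= 1; the second branch is U(1). *)
Definition U x (i : int) : 'rV[\bar R]_3 :=
  if i <= 0 then row3 (cntA x i) (cntB x i) (cntC x i)
  else row3 (`[< last_jump x 0 1 >])%:R%:E
            (`[< last_jump x (-1) 1 >])%:R%:E
            (`[< last_jump x 0 2 >])%:R%:E.

Definition unit_vec (k : 'I_3) : 'rV[\bar R]_3 := \row_l (k == l)%:R%:E.

(* Entry (k, l) is E_Q[U(i)_l | U(i+1) = e_k], the mean number of type-l
   particles in the offspring (in generation -i+1) of one type-k particle. *)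
Definition offspring_mean (Q : probability paths R) (i : int) :
    'M[\bar R]_3 :=
  \matrix_(k, l)
    ((\int[Q]_(x in [set x : paths | U x (i + 1) = unit_vec k]) U x i ord0 l) /
     Q [set x : paths | U x (i + 1) = unit_vec k])%E.

Variable Pw : env R -> int -> probability paths R.

Definition Nmx (w : env R) (i : int) : 'M[R]_3 :=
  let a := alpha Pw w i in
  let b := beta Pw w i in
  \matrix_(k < 3)
    tnth [tuple row3 (a / (1 - a - b)) (b / (1 - a - b)) 0;
                row3 (a / (1 - a - b)) (b / (1 - a - b)) 1;
                row3 (a / (1 - a - b)) (b / (1 - a - b)) 0] k.

(* \sum_(i <= 0) N(0) N(-1) ... N(i), entrywise, possibly +oo *)
Definition Nsum (w : env R) : 'M[\bar R]_3 :=
  \matrix_(k, l) (\sum_(0 <= n <oo)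
    ((\prod_(j < n.+1) Nmx w (- (j%:Z))) k l)%:E)%E.

Definition immigrant_mean (w : env R) : 'rV[R]_3 :=
  (1 - alpha Pw w 0 - beta Pw w 0)^-1 *:
    row3 (jp1 (w 0)) (gamma Pw w 0) (jp2 (w 0)).

(* Row vector times matrix and Euclidean inner product with extended-real
   entries (\bar R is not a ring, so *m is not available). *)
Definition erow_mul (v : 'rV[R]_3) (S : 'M[\bar R]_3) : 'rV[\bar R]_3 :=
  \row_l (\sum_k (v ord0 k)%:E * S k l)%E.

Definition einner (u : 'rV[R]_3) (v : 'rV[\bar R]_3) : \bar R :=
  (\sum_l (u ord0 l)%:E * v ord0 l)%E.

End branching.

(* Main.v *)
Require Import Defs.
From HB Require Import structures.
From mathcomp Require Import all_boot all_order all_algebra.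
From mathcomp Require Import all_classical all_reals all_analysis.
From mathcomp Require Import measurable_realfun.
From mathcomp Require Import zify ring lra.
Set Implicit Arguments.
Unset Strict Implicit.
Unset Printing Implicit Defensive.
Import Order.TTheory GRing.Theory Num.Theory.
Import numFieldNormedType.Exports.
Local Open Scope classical_set_scope.
Local Open Scope ring_scope.

(** Each step from [i] to [i - 1] before [T1] is matched with the jump that
    completes its crossing-back, so that [U(i)] is the vector of the numbers of
    jumps [i-1 -> i], [i-2 -> i], [i-1 -> i+1] made before [T1], for all [i <= 1].
    As [T1] is almost surely finite, expectations are sums over the words
    (sequences of steps) of first exit from [(-oo, 0]].

    Cutting out the loop at [i] that is closed by a jump [i-1 -> i]
    (resp. [i-2 -> i]) leaves a word with a marked visit to [i], and changes
    neither [U(i+1)] nor the exit.  Hence, on any event [K] determined by [U(i+1)],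
    [E[A(i); K] = alpha(i) E[V(i); K]] and [E[B(i); K] = beta(i) E[V(i); K]],
    where [V(i)] is the number of visits to [i].  Pathwise
    [V(i) = A(i) + B(i) + |U(i+1)|] and [C(i) = B(i+1)]; solving for [E[V(i); K]]
    gives [E[U(i); K] = E[U(i+1); K] N(i)].  With [K] the event that [U(i+1)] is a
    unit vector this is the offspring mean; with [K] trivial it gives
    [E[U(i)] = E[U(1)] N(0) ... N(i)], and [E T1] is the sum of the [E[V(i)]]. *)

(** * Words *)

Definition step (z : int) : bool := z \in [:: -1; 1; 2].

Lemma stepP z : reflect [\/ z = -1, z = 1 | z = 2] (step z).
Proof.
apply: (iffP idP); rewrite /step !inE.
  by case/or3P => /eqP ->; [constructor 1|constructor 2|constructor 3].
by case=> ->.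
Qed.

(** Words list increments, and the starting point is a separate argument, so cutting a loop out of a
    word leaves the remaining letters as they are. *)
Definition pos (k : int) (s : seq int) : int := foldl +%R k s.

Lemma pos_cat k s t : pos k (s ++ t) = pos (pos k s) t.
Proof. exact: foldl_cat. Qed.

Fixpoint word (c k j : int) (s : seq int) : bool :=
  (k <= c) && if s is z :: s' then step z && word c (k + z) j s' else k == j.

Fixpoint exit_word (c k : int) (s : seq int) : bool :=
  if s is z :: s' then [&& k <= c, step z & exit_word c (k + z) s']
  else c < k.

(** The final position is not counted: these are departures, so the visits of a word to all sites
    add up to its length. *)
Fixpoint visits (i k : int) (s : seq int) : nat :=
  if s is z :: s' then ((k == i)%R + visits i (k + z)%R s')%N else 0%N.
Arguments visits (i k)%_R s.

Fixpoint jumps (a b k : int) (s : seq int) : nat :=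
  if s is z :: s' then (((k == a)%R && (k + z == b)%R) + jumps a b (k + z)%R
    s')%N else 0%N.
Arguments jumps (a b k)%_R s.

Lemma word_pos c k j s : word c k j s -> pos k s = j.
Proof. by elim: s k => [|z s IH] k /= /andP[_]; [move/eqP|case/andP=> _ /IH]. Qed.

Lemma word_le_end c k j s : word c k j s -> j <= c.
Proof. by elim: s k => [|z s IH] k /= /andP[kc]; [move/eqP <-|case/andP=> _ /IH]. Qed.

Lemma word_le_start c k j s : word c k j s -> k <= c.
Proof. by case: s => [|z s] /= /andP[]. Qed.

Lemma word_widen c c' k j s : c <= c' -> word c k j s -> word c' k j s.
Proof.
move=> cc'; elim: s k => [|z s IH] k /= /andP[kc]; rewrite (le_trans kc cc')//=.
by case/andP=> -> /IH.
Qed.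

Lemma word_cat c k j s t :
  word c k j (s ++ t) = word c k (pos k s) s && word c (pos k s) j t.
Proof.
elim: s k => [|z s IH] k /=; first by rewrite eqxx andbT; case: t => [|y t] /=;
  case: (k <= c).
by rewrite IH !andbA.
Qed.

Lemma exit_word_cat c k s t : pos k s <= c ->
  exit_word c k (s ++ t) = word c k (pos k s) s && exit_word c (pos k s) t.
Proof.
elim: s k => [|z s IH] k /= kc; first by rewrite kc eqxx.
by rewrite IH// !andbA.
Qed.

Lemma jumps_cat a b k s t :
  jumps a b k (s ++ t) = (jumps a b k s + jumps a b (pos k s) t)%N.
Proof. by elim: s k => [|z s IH] k //=; rewrite IH addnA. Qed.

Lemma jumps_word0 a b c k j s : word c k j s -> c < b -> jumps a b k s = 0%N.
Proof.
move=> + cb; elim: s k => [|z s IH] k //= /andP[_ /andP[_ ws]].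
rewrite IH// addn0; have := word_le_start ws.
by case: eqP => //= _; case: eqP => //=; lia.
Qed.

(** The only downward step is [-1], so a word from [k >= j] to [m < j] must step from [j] to
    [j - 1]; [l] is what follows the last such step and therefore stays below [j]. *)
Lemma last_exit c k j m s : word c k m s -> m < j -> j <= k ->
  exists t l, [/\ s = t ++ -1 :: l, word c k j t & word (j - 1) (j - 1) m l].
Proof.
elim/last_ind: s m => [|s z IH] m /=; first by move=> /andP[_ /eqP ->]; lia.
rewrite -cats1 word_cat /= => /and3P[ws _ /and3P[stepz mc /eqP em]] mj jk.
have [lt_j|ge_j] := ltP (pos k s) j.
  have [t [l [es wt wl]]] := IH _ ws lt_j jk.
  exists t, (rcons l z); split => //; first by rewrite es -catA /= cats1.
  rewrite -cats1 word_cat (word_pos wl) wl /= stepz em eqxx andbT.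
  have := word_le_end wl; lia.
have [ez ej] : z = -1 /\ pos k s = j by case/stepP: stepz; lia.
exists s, [::]; split; rewrite -?ej ?ez // /=; lia.
Qed.

(** If one splitting letter came strictly earlier, its remainder would contain the later visit to
    [j], above the ceiling [j - 1]. *)
Lemma last_exit_inj c k j m t l t' l' :
  word c k j t -> word (j - 1) (j - 1) m l ->
  word c k j t' -> word (j - 1) (j - 1) m l' ->
  t ++ -1 :: l = t' ++ -1 :: l' -> (t, l) = (t', l').
Proof.
wlog tt' : t l t' l' / (size t <= size t')%N.
  move=> W h1 h2 h3 h4 e.
  by case: (leqP (size t) (size t')) => [?|/ltnW ?]; [|apply/esym]; exact: W.
move=> wt wl wt' wl' e.
have et : t = take (size t) t'.
  have := congr1 (take (size t)) e; rewrite take_size_cat// => {1}->.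
  by rewrite takel_cat.
have := cat_take_drop (size t) t'; rewrite -et => et'.
case E : (drop (size t) t') et' => [|z r] et'.
  move: e; rewrite -et' cats0 => /eqP; rewrite eqseq_cat// eqxx /= => /eqP[->].
  by [].
move: e; rewrite -et' -catA => /eqP; rewrite eqseq_cat// eqxx /= => /eqP[ez el].
move: wt'; rewrite -et' word_cat -ez => /andP[_]; rewrite (word_pos wt) /=.
move=> /andP[_ wr].
move: wl; rewrite el word_cat (word_pos wr) => /andP[/word_le_end]; lia.
Qed.

(** A visit to [i] is the start or an arrival from [i - 1], [i - 2] or [i + 1]. The end point, which
    [visits] omits, is positive and hence not [i]. *)
Lemma visits_exit_word i k s : i <= 0 -> exit_word 0 k s ->
  visits i k s =
  ((k == i)%R + jumps (i - 1) i k s + jumps (i - 2) i k s + jumps (i + 1) i k s)%N.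
Proof.
move=> i0; elim: s k => [|z s IH] k /= => [|/and3P[k0 /stepP sz /IH ->]]; first lia.
case: sz => ->; lia.
Qed.

(** The word ends above [i], so the upward crossings of the edge between [i] and [i + 1] exceed the
    downward ones by one if it starts at or below [i], and balance them otherwise. *)
Lemma upcross_exit_word i k s : i <= 0 -> exit_word 0 k s ->
  (jumps i (i + 1) k s + jumps (i - 1) (i + 1) k s + jumps i (i + 2) k s +
   (i < k)%R)%N = (jumps (i + 1) i k s).+1.
Proof.
move=> i0; elim: s k => [|z s IH] k /= => [|/and3P[k0 /stepP sz /IH]]; first lia.
case: sz => ->; lia.
Qed.

(** The bound on [n] covers every site visited, and it passes to the tail of the word: a step raises
    the absolute value of the position by at most 2. *)
Lemma sum_visits_exit_word k s n : exit_word 0 k s -> (absz k + (size s).*2 <= n)%N ->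
  (\sum_(j < n) visits (- j%:Z) k s)%N = size s.
Proof.
elim: s k => [|z s IH] k /=; first by move=> *; rewrite big1.
move=> /and3P[k0 /stepP sz es] sn; rewrite big_split /= IH//;
  last by case: sz => ->; lia.
have kn : (absz k < n)%N by lia.
rewrite (bigD1 (Ordinal kn))//= big1 ?addn0 => [|j]; first lia.
by rewrite -val_eqE /= => jk; apply/eqP; rewrite eqb0; apply: contraNN jk; lia.
Qed.

Lemma pickle_inv_surj (T : countType) (t : T) : exists n, pickle_inv n = Some t.
Proof. by exists (pickle t); exact: pickleK_inv. Qed.

(** * Sums over words *)

Section esum_extra.
Context {R : realType}.
Local Open Scope ereal_scope.

Lemma esumZl (T : choiceType) (I : set T) (c : \bar R) (a : T -> \bar R) :
  0 <= c -> (forall i, 0 <= a i) ->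
  \esum_(i in I) (c * a i) = c * \esum_(i in I) a i.
Proof.
move=> c0 a0; apply/eqP; rewrite eq_le; apply/andP; split.
  apply: ge_ereal_sup => _ [X [finX XI] <-].
  rewrite -ge0_mule_fsumr// lee_pmul//; first by rewrite fsume_ge0.
  by apply: esum_ge; exists X.
case: c c0 => [r| |//]; rewrite ?lee_fin => c0.
  have [->|r0] := eqVneq r 0%R; first by rewrite mul0e esum_ge0// => i _; rewrite mul0e.
  have rgt0 : (0 < r)%R by rewrite lt_neqAle eq_sym r0.
  rewrite -lee_pdivlMl//; apply: ge_ereal_sup => _ [X [finX XI] <-].
  rewrite lee_pdivlMl// ge0_mule_fsumr//; apply: esum_ge; by exists X.
(* Remaining case [c = +oo]: either all terms vanish, or one nonzero term makes the sum of the
   products infinite. *)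
have [a00|] := pselect (forall i, I i -> a i = 0).
  by rewrite [X in _ * X]esum1// mule0 esum_ge0// => i _; exact: mule_ge0.
move=> /existsNP[i /not_implyP[Ii /eqP ai]].
have -> : \esum_(j in I) (+oo * a j) = +oo; last by rewrite leey.
apply/eqP; rewrite -leye_eq; apply: esum_ge; exists [set i].
  by split => [|_ ->//]; exact: finite_set1.
by rewrite fsbig_set1 gt0_mulye// lt0e ai a0.
Qed.

Lemma esum_ord (N : nat) (P : pred nat) (f : nat -> \bar R) :
  (forall n, 0 <= f n) ->
  \esum_(n in [set n | (n < N)%N && P n]) f n = \sum_(n < N | P n) f n.
Proof.
move=> f0; rewrite (_ : [set _ | _] = `I_N `&` [set n | P n]); last first.
  by apply/seteqP; split=> n /= /andP.
rewrite esum_mkcondr esum_fset//; last by move=> i _; case: ifP.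
by rewrite -fsbig_ord [RHS]big_mkcond; apply: eq_bigr => n _; rewrite mem_setE.
Qed.

(* A position [n < size s] of a word [s] is recorded by the splitting of [s]
   into its first [n] letters and a nonempty remainder. *)
Lemma esum_marked (K : set (seq int)) (m : seq int -> seq int -> bool)
    (f : seq int -> \bar R) : (forall s, 0 <= f s) ->
  \esum_(s in K)
     ((\sum_(n < size s) m (take n s) (drop n s))%N%:R%:E * f s) =
  \esum_(p in [set p | [/\ K (p.1 ++ p.2), m p.1 p.2 & p.2 <> [::]]])
     f (p.1 ++ p.2).
Proof.
move=> f0.
pose J s := [set n | (n < size s)%N && m (take n s) (drop n s)].
transitivity (\esum_(s in K) \esum_(n in J s) f s).
  apply: eq_esum => s _; rewrite esum_ord//.
  rewrite natr_sum -sumEFin ge0_sume_distrl; last by move=> i _; rewrite lee_fin.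
  by rewrite [RHS]big_mkcond; apply: eq_bigr => n _; case: (m _ _);
    rewrite ?mul1e ?mul0e.
rewrite esum_esum//.
pose e (p : seq int * seq int) : seq int * nat := (p.1 ++ p.2, size p.1).
rewrite (reindex_esum [set p | [/\ K (p.1 ++ p.2), m p.1 p.2 & p.2 <> [::]]] _ e)//.
split.
- move=> [u v] /= [Kuv muv v0]; rewrite /e /J /=; split => //=.
  by rewrite take_size_cat// drop_size_cat// muv size_cat -[ltnLHS]addn0
    ltn_add2l; case: v v0 {Kuv muv}.
- by move=> [u v] [u' v'] _ _ [/eqP]; rewrite /= => + su;
  rewrite eqseq_cat// => /andP[/eqP-> /eqP->].
- move=> [s n] /= [Ks /andP[ns mn]]; exists (take n s, drop n s) => /=.
    rewrite cat_take_drop; split => // /(congr1 size); rewrite size_drop /=; lia.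
  by rewrite /e /= cat_take_drop size_take ns.
Qed.

(** Countability turns a sum over words into a series indexed by [nat], the form to which
    measurability of series and termwise integration apply. *)
Lemma esum_pickle (T : countType) (I : set T) (a : T -> \bar R) :
  (forall t, 0 <= a t) ->
  \esum_(t in I) a t =
  \sum_(n <oo) (if @pickle_inv T n is Some t then
                  if t \in I then a t else 0 else 0).
Proof.
move=> a0; pose b n := if @pickle_inv T n is Some t then
                          if t \in I then a t else 0 else 0.
have b0 n : 0 <= b n by rewrite /b; case: (pickle_inv n) => // t; case: ifP.
rewrite -[RHS]/(\sum_(n <oo) b n) nneseries_esumT// esum_mkcond.
transitivity (\esum_(n in range (@pickle T)) b n).
  rewrite (reindex_esum setT _ (@pickle T)).
    apply: eq_esum => t _; rewrite /b. by rewrite pickleK_inv.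
  split=> [t _|t t' _ _ e|//]; first by exists t.
  exact: (pcan_inj (@pickleK T) e).
rewrite esum_mkcond; apply: eq_esum => n _; case: ifPn => // /negP nR.
rewrite /b; case E : (pickle_inv n) => [t|//]; exfalso; apply: nR.
by rewrite inE /=; exists t => //; have := @pickle_invK T n; rewrite E.
Qed.

End esum_extra.

(** * Weights of words and the Green function of the killed walk *)

Section words.
Context {R : realType} (w : env R).
Implicit Types (s t u v : seq int).

Fixpoint wt (k : int) s : R :=
  if s is z :: s' then trans w k (k + z) * wt (k + z) s' else 1.

Lemma trans_ge0 a b : 0 <= trans w a b.
Proof. by rewrite /trans; do !case: ifP => // _;
  [exact: jq_ge0|exact: jp1_ge0|exact: jp2_ge0]. Qed.

Lemma wt_ge0 k s : 0 <= wt k s.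
Proof. by elim: s k => [|z s IH] k //=; rewrite mulr_ge0// trans_ge0. Qed.

Lemma wt_cat k s t : wt k (s ++ t) = wt k s * wt (pos k s) t.
Proof. by elim: s k => [|z s IH] k /=; rewrite ?mul1r// IH mulrA. Qed.

Local Open Scope ereal_scope.

Lemma wtE_ge0 k s : 0 <= (wt k s)%:E.
Proof. by rewrite lee_fin wt_ge0. Qed.

Lemma esum_last_exit (c k j m : int) (f : seq int -> \bar R) :
  (forall s, 0 <= f s) -> (m < j)%R -> (j <= k)%R ->
  \esum_(s in [set s | word c k m s]) f s =
  \esum_(t in [set t | word c k j t])
    \esum_(l in [set l | word (j - 1) (j - 1) m l]) f (t ++ (-1)%R :: l).
Proof.
move=> f0 mj jk; rewrite esum_esum//.
pose e (p : seq int * seq int) := p.1 ++ (-1)%R :: p.2.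
rewrite [LHS](reindex_esum ([set t | word c k j t] `*``
  (fun=> [set l | word (j - 1) (j - 1) m l])) _ e)//; split.
- move=> [t l] /= [wt wl]; rewrite word_cat (word_pos wt) wt /= (word_le_end wt).
  by rewrite (word_widen _ wl)//; have := word_le_end wt; lia.
- move=> [t l] [t' l'] /set_mem[/= wt wl] /set_mem[/= wt' wl'] /=.
  exact: last_exit_inj wt wl wt' wl'.
- move=> s /= ws; have [t [l [-> wt wl]]] := last_exit ws mj jk.
  by exists (t, l).
Qed.

(* Green function of the walk killed above [c]. *)
Definition mass (c k j : int) : \bar R :=
  \esum_(s in [set s | word c k j s]) (wt k s)%:E.

Lemma mass_ge0 c k j : 0 <= mass c k j.
Proof. by apply: esum_ge0 => s _; exact: wtE_ge0. Qed.

Lemma trans_down j : trans w j (j - 1) = jq (w j).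
Proof. by rewrite /trans eqxx. Qed.

Lemma trans_up1 j : trans w j (j + 1) = jp1 (w j).
Proof. by rewrite /trans; case: eqP; [lia|rewrite eqxx]. Qed.

Lemma trans_up2 j : trans w j (j + 2) = jp2 (w j).
Proof. by rewrite /trans; case: eqP; [lia|case: eqP; [lia|rewrite eqxx]]. Qed.

(** Weights multiply along the splitting at the last step from [j] to [j - 1], and the two pieces
    vary independently. *)
Lemma mass_last_exit c k j m : (m < j)%R -> (j <= k)%R ->
  mass c k m = mass c k j * ((jq (w j))%:E * mass (j - 1) (j - 1) m).
Proof.
move=> mj jk; rewrite {1}/mass (esum_last_exit c (wtE_ge0 k) mj jk).
rewrite muleC -esumZl; last 2 first.
- by rewrite mule_ge0 ?mass_ge0// lee_fin jq_ge0.
- by move=> i; exact: wtE_ge0.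
apply: eq_esum => t /= wt_t.
rewrite muleC muleA -EFinM -esumZl; last 2 first.
- by rewrite lee_fin mulr_ge0 ?wt_ge0 ?jq_ge0.
- by move=> i; exact: wtE_ge0.
apply: eq_esum => l _.
by rewrite wt_cat (word_pos wt_t) /= trans_down -EFinM mulrA.
Qed.

Lemma visitsE i k s :
  visits i k s = (\sum_(n < size s) (pos k (take n s) == i))%N.
Proof.
elim: s k => [|z s IH] k /=; first by rewrite big_ord0.
by rewrite big_ord_recl /= IH.
Qed.

Lemma jumpsE a b k s :
  jumps a b k s = (\sum_(n < size s)
    ((pos k (take n s) == a) && (ohead (drop n s) == Some (b - a)%R)))%N.
Proof.
elim: s k => [|z s IH] k /=; first by rewrite big_ord0.
rewrite big_ord_recl /= IH; congr (_ + _)%N.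
case: eqP => //= ->; congr nat_of_bool; apply/eqP/eqP => [<-|[->]]; last lia.
by congr Some; lia.
Qed.

Lemma esum_visits (K : set (seq int)) c k i (f : seq int -> \bar R) :
  (forall s, 0 <= f s) -> K `<=` [set s | exit_word c k s] -> (i <= c)%R ->
  \esum_(s in K) ((visits i k s)%:R%:E * f s) =
  \esum_(u in [set u | word c k i u]) \esum_(v in [set v | K (u ++ v)]) f (u ++ v).
Proof.
move=> f0 Kc ic; under eq_esum do rewrite visitsE.
rewrite (esum_marked K (fun u _ => pos k u == i) f0) esum_esum//.
congr esum; apply/seteqP; split=> -[u v] /= [].
  move=> Kuv /eqP ui v0; split=> //.
  by have := Kc _ Kuv; rewrite /= exit_word_cat ?ui// => /andP[].
move=> wu Kuv; split=> //; first by rewrite (word_pos wu).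
move=> v0; have := Kc _ Kuv;
  rewrite v0 /= exit_word_cat (word_pos wu)//= => /andP[]; lia.
Qed.

Lemma esum_jumps (K : set (seq int)) c k a b (f : seq int -> \bar R) :
  (forall s, 0 <= f s) -> K `<=` [set s | exit_word c k s] -> (a <= c)%R ->
  \esum_(s in K) ((jumps a b k s)%:R%:E * f s) =
  \esum_(u in [set u | word c k a u])
    \esum_(v in [set v | K (u ++ (b - a)%R :: v)]) f (u ++ (b - a)%R :: v).
Proof.
move=> f0 Kc ac; under eq_esum do rewrite jumpsE.
rewrite (esum_marked K (fun u v => (pos k u == a) && (ohead v == Some (b - a)%R)) f0).
rewrite esum_esum//.
pose e (p : seq int * seq int) := (p.1, (b - a)%R :: p.2).
rewrite [LHS](reindex_esum ([set u | word c k a u] `*``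
  (fun u => [set v | K (u ++ (b - a)%R :: v)])) _ e)//; split.
- move=> [u v] /= [wu Kuv]; split=> //.
  by rewrite (word_pos wu) !eqxx.
- by move=> [u v] [u' v'] _ _ [-> ->].
- move=> [u [|z v]] /= []; first by rewrite andbF.
  move=> Kuv /andP[/eqP ua /eqP[ez]] _; rewrite {}ez in Kuv *.
  exists (u, v) => //=; split=> //.
  by have := Kc _ Kuv; rewrite /= exit_word_cat ?ua// => /andP[].
Qed.

(* A jump from [a] to [i] closes a loop at [i] below [i]; cutting the loop out
   leaves a word of [K] with a marked visit to [i]. *)
Lemma esum_excise (K : set (seq int)) i a :
  K `<=` [set s | exit_word 0 0 s] -> (i <= 0)%R -> (a < i)%R ->
  (forall t l v, word 0 0 i t -> word (i - 1) (i - 1) a l ->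
     K (t ++ (-1)%R :: l ++ (i - a)%R :: v) <-> K (t ++ v)) ->
  \esum_(s in K) ((jumps a i 0 s)%:R%:E * (wt 0 s)%:E) =
  (jq (w i))%:E * mass (i - 1) (i - 1) a * (trans w a i)%:E *
  \esum_(s in K) ((visits i 0 s)%:R%:E * (wt 0 s)%:E).
Proof.
move=> Kc i0 ai HK.
rewrite (esum_visits _ Kc i0) ?(esum_jumps _ _ Kc)//; last 3 first.
- by move=> s; exact: wtE_ge0.
- lia.
- by move=> s; exact: wtE_ge0.
(* The word before the marked jump leads from 0 to [a < i], so it splits at its last exit from [i]
   into [t] and the loop part [l]. *)
rewrite (@esum_last_exit _ _ i) //; last by move=> s;
  exact/esum_ge0/(fun _ _ => wtE_ge0 _ _).
rewrite -esumZl; last 2 first.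
- by rewrite !mule_ge0 ?mass_ge0// lee_fin ?jq_ge0 ?trans_ge0.
- by move=> s; exact/esum_ge0/(fun _ _ => wtE_ge0 _ _).
apply: eq_esum => t wt_t.
(* Membership in [K] is blind to the loop, so the weight [X] of the words of [K] that begin with [t]
   does not depend on [l] and factors out of the loop sum. *)
set X := esum _ (fun v => (wt 0 (t ++ v))%:E).
have X0 : 0 <= X by exact/esum_ge0/(fun _ _ => wtE_ge0 _ _).
transitivity (\esum_(l in [set l | word (i - 1) (i - 1) a l])
   ((jq (w i))%:E * (trans w a i)%:E * X * (wt (i - 1) l)%:E)).
  apply: eq_esum => l wl; rewrite muleAC -!EFinM /X -esumZl; last 2 first.
  - by rewrite lee_fin !mulr_ge0 ?jq_ge0 ?trans_ge0 ?wt_ge0.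
  - by move=> v; exact: wtE_ge0.
  rewrite (_ : [set v | K ((t ++ (-1)%R :: l) ++ (i - a)%R :: v)] = [set v | K (t
    ++ v)]).
    apply: eq_esum => v _;
      rewrite -EFinM !wt_cat pos_cat /= (word_pos wt_t) (word_pos wl) /=.
    by rewrite trans_down (addrC a) subrK; congr EFin; ring.
  by apply/seteqP; split=> v /=; rewrite -catA /= HK.
rewrite esumZl; last 2 first.
- by rewrite mule_ge0// -EFinM lee_fin mulr_ge0 ?jq_ge0 ?trans_ge0.
- by move=> s; exact: wtE_ge0.
by rewrite -/(mass _ _ _) muleAC; congr (_ * _); rewrite muleAC.
Qed.

End words.

(** * Path measures and words *)

Lemma measurable_coord n k : measurable [set x : paths | x n = k].
Proof. by apply: sub_sigma_algebra; exists n, k. Qed.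

Lemma measurable_prefix n (A : set (seq int)) :
  measurable [set x : paths | A (mkseq x n)].
Proof.
have mE m s : measurable [set x : paths | mkseq x m = s].
  elim: m s => [|m IH] s.
    have [->|s0] := pselect (s = [::]).
      rewrite (_ : [set _ | _] = setT)//; by apply/seteqP.
    rewrite (_ : [set _ | _] = set0)//; apply/seteqP; split=> // x /= e; exact: s0.
  elim/last_ind: s => [|s z _].
    by rewrite (_ : [set _ | _] = set0)//; apply/seteqP; split=> x.
  rewrite (_ : [set _ | _] = [set x : paths | mkseq x m = s] `&` [set x : paths |
    x m = z]).
    by apply: measurableI => //; exact: measurable_coord.
  apply/seteqP; split=> x /=; rewrite mkseqS; first by move=> /rcons_inj[].
  by move=> [-> ->].
rewrite (_ : [set _ | _] = \bigcup_(s : seq int)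
    ([set x : paths | mkseq x n = s] `&` [set _ | A s])).
  apply: countable_bigcupT_measurable => // s.
  have [As|As] := pselect (A s).
    by rewrite (_ : [set _ | A s] = setT) ?setIT//; apply/seteqP; split.
  by rewrite (_ : [set _ | A s] = set0) ?setI0//; apply/seteqP; split.
apply/seteqP; split=> x /=; first by move=> Ax; exists (mkseq x n).
by move=> [s _ [<-]].
Qed.

Definition path_word (x : nat -> int) (N : nat) : seq int :=
  mkseq (fun n => x n.+1 - x n) N.

Lemma size_path_word x N : size (path_word x N) = N.
Proof. exact: size_mkseq. Qed.

Lemma path_wordS x N : path_word x N.+1 = rcons (path_word x N) (x N.+1 - x N).
Proof. exact: mkseqS. Qed.

Lemma path_word_cons x N :
  path_word x N.+1 = (x 1%N - x 0%N) :: path_word (x \o succn) N.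
Proof. by rewrite /path_word /mkseq /= -[1%N]addn0 iotaDl -map_comp. Qed.

Lemma pos_path_word x N : pos (x 0%N) (path_word x N) = x N.
Proof.
elim: N => [//|N IH]; rewrite path_wordS -cats1 pos_cat IH /=; lia.
Qed.

Lemma take_path_word x n N : (n <= N)%N -> take n (path_word x N) = path_word x n.
Proof.
move=> nN; rewrite /path_word /mkseq -map_take take_iota.
by rewrite (minn_idPl nN).
Qed.

Definition cylinder (k : int) (s : seq int) : set paths :=
  [set x | x 0%N = k /\ path_word x (size s) = s].

Lemma cylinderE k s :
  cylinder k s = [set x : paths | forall m, (m <= size s)%N -> x m = pos k (take m s)].
Proof.
apply/seteqP; split=> x /=.
  move=> [x0 xs] m ms; rewrite -[RHS](_ : pos (x 0%N) (path_word x m) = _).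
    by rewrite pos_path_word.
  by rewrite x0 -[in RHS]xs take_path_word.
move=> H; have x0 := H 0%N isT; split; first by rewrite x0 take0.
apply: (@eq_from_nth _ 0); rewrite size_path_word// => n ns.
rewrite nth_mkseq// !H ?(ltnW ns)// (take_nth 0)// -cats1 pos_cat /=; lia.
Qed.

Lemma measurable_cylinder k s : measurable (cylinder k s).
Proof.
rewrite (_ : cylinder k s = [set x : paths | x 0%N = k] `&`
  [set x : paths | mkseq (fun n => nth 0 (mkseq x (size s).+1) n.+1 -
                     nth 0 (mkseq x (size s).+1) n) (size s) = s]).
  apply: measurableI; first exact: measurable_coord.
  exact: (measurable_prefix (size s).+1
    [set t | mkseq (fun n => nth 0 t n.+1 - nth 0 t n) (size s) = s]).
have E (x : paths) : path_word x (size s) =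
    mkseq (fun n => nth 0 (mkseq x (size s).+1) n.+1 -
                     nth 0 (mkseq x (size s).+1) n) (size s).
  apply: (@eq_from_nth _ 0); rewrite !size_mkseq// => i si.
  by rewrite !nth_mkseq// ltnW.
by apply/seteqP; split=> x /=; rewrite /cylinder /= E.
Qed.

Section walk_law.
Context {R : realType} (w : env R) (k : int) (Q : probability paths R).
Hypothesis hQ : is_walk_law w k Q.

Lemma walk_law_cylinder s : Q (cylinder k s) = (wt w k s)%:E.
Proof.
elim/last_ind: s => [|s z IH].
  rewrite -hQ.1; congr (Q _); apply/seteqP; split=> x /=; first by case.
  by move=> ?; split.
have := hQ.2 (size s) (fun m => pos k (take m (rcons s z))).
rewrite -{1}(size_rcons s z) -cylinderE => ->.
rewrite (_ : [set x : paths | _] = cylinder k s).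
  rewrite IH -EFinM -cats1 wt_cat /= mulr1 take_size_cat// take_oversize
    ?size_cat//= ?addn1//.
  by rewrite pos_cat /=.
rewrite cylinderE; apply/seteqP; split=> x /= H m ms; rewrite H// -cats1 takel_cat//.
Qed.

Definition proper_path (x : nat -> int) : Prop :=
  x 0%N = k /\ forall n, step (x n.+1 - x n).

Lemma trans_eq0 a z : ~~ step z -> trans w a (a + z) = 0.
Proof.
rewrite /step !inE !negb_or => /and3P[z1 z2 z3]; rewrite /trans.
by do !(case: eqP => [|_]; first lia).
Qed.

(** A path with the right start and a forbidden step has a prefix of weight zero, hence lies in one
    of countably many null cylinders. *)
Lemma proper_ae : {ae Q, forall x, proper_path x}.
Proof.
pose F n := if @pickle_inv (seq int) n is Some s then
  if wt w k s == 0 then cylinder k s else set0 else set0.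
have nF n : Q.-negligible (F n).
  rewrite /F; case: pickle_inv => [s|]; last exact: negligible_set0.
  case: eqP => ws; last exact: negligible_set0.
  exists (cylinder k s); split=> //; first exact: measurable_cylinder.
  by have := walk_law_cylinder s; rewrite ws => ->.
apply: (@negligibleS _ _ _ _ (~` [set x : paths | x 0%N = k] `|` \bigcup_n F n)).
  move=> x /= /not_andP[x0|/existsNP[n /negP xn]]; first by left.
  have [x0|] := pselect (x 0%N = k); last by left.
  have [m Em] := pickle_inv_surj (path_word x n.+1).
  right; exists m => //;
    rewrite /F Em path_wordS -cats1 wt_cat /= -x0 pos_path_word trans_eq0// mul0r
      mulr0 eqxx.
  by rewrite /cylinder /= cats1 -path_wordS size_path_word.
apply: negligibleU; last exact: negligible_bigcup.
exists (~` [set x : paths | x 0%N = k]); split=> //.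
  by apply: measurableC; exact: measurable_coord.
apply: etrans (probability_setC Q (measurable_coord 0 k)) _.
by rewrite hQ.1 subee.
Qed.

(** * Expectations as sums over exit words *)

Definition exits (c : int) (x : nat -> int) (N : nat) : Prop :=
  c < x N /\ forall m, (m < N)%N -> x m <= c.

Lemma exits_inj c x N N' : exits c x N -> exits c x N' -> N = N'.
Proof.
move=> [xN HN] [xN' HN']; apply/eqP; rewrite eqn_leq; apply/andP.
by split; rewrite leqNgt; apply/negP => h; [have := HN _ h|have := HN' _ h]; lia.
Qed.

Lemma exit_word_path c x N : proper_path x -> exits c x N ->
  exit_word c k (path_word x N).
Proof.
move=> [<- sx] [xN HN].
elim: N x sx xN HN => [|N IH] x sx xN HN; first exact: xN.
rewrite path_word_cons /= HN// sx /= addrC subrK.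
by apply: (IH (x \o succn)) => //= m mN; exact: HN.
Qed.

Lemma cylinder_exits c s x : exit_word c k s -> cylinder k s x -> exits c x (size s).
Proof.
rewrite cylinderE /= => es H; split.
  rewrite H// take_size; elim: s k es {H} => [//|z s IH] k' /= /and3P[_ _].
  exact: IH.
move=> m ms; rewrite H ?(ltnW ms)//;
  elim: s k m es ms {H} => [//|z s IH] k' [|m] /= /and3P[k'c _ es] // ms.
exact: IH.
Qed.

(** On a proper path that exits, exactly one cylinder indicator survives and the sum is [F] at the
    exit word; without exit it is 0. Being a countable sum, it is measurable and can be integrated
    term by term. *)
Definition transfer_fun (c : int) (F : seq int -> R) (x : paths) : \bar R :=
  \esum_(s in [set s | exit_word c k s]) (F s * \1_(cylinder k s) x)%:E.

Lemma transfer_fun_exit c F x N : (forall s, 0 <= F s) ->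
  proper_path x -> exits c x N -> transfer_fun c F x = (F (path_word x N))%:E.
Proof.
move=> F0 px xN; rewrite /transfer_fun.
have -> : (F (path_word x N))%:E = \esum_(s in [set path_word x N])
    (F s * \1_(cylinder k s) x)%:E.
  rewrite esum_set1; last by rewrite lee_fin mulr_ge0.
  rewrite indicE mem_set ?mulr1// /cylinder /= size_path_word; split=> //; exact: px.1.
rewrite esum_mkcond [RHS]esum_mkcond; apply: eq_esum => s _.
have [es|es] := pselect (exit_word c k s).
  rewrite (mem_set (_ : [set s | exit_word c k s] s))//.
  have [->|sN] := eqVneq s (path_word x N).
    by rewrite (mem_set (_ : [set path_word x N] (path_word x N))).
  rewrite memNset/=; last exact/eqP.
  rewrite indicE memNset ?mulr0// => xs; move/eqP: sN; apply.
  have sz := exits_inj (cylinder_exits es xs) xN.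
  by case: xs => _ <-; rewrite sz.
rewrite memNset// memNset//= => sE; apply: es; rewrite sE; exact: exit_word_path.
Qed.

Lemma transfer_fun_noexit c F x :
  (forall N, ~ exits c x N) -> transfer_fun c F x = 0%E.
Proof.
move=> xN; apply: esum1 => s /= es; rewrite indicE memNset ?mulr0// => xs.
exact: (xN _ (cylinder_exits es xs)).
Qed.

Lemma transfer_fun_ge0 c F x : (forall s, 0 <= F s) -> (0 <= transfer_fun c F x)%E.
Proof. by move=> F0; apply: esum_ge0 => s _; rewrite lee_fin mulr_ge0. Qed.

Let term c (F : seq int -> R) (n : nat) (x : paths) : \bar R :=
  if @pickle_inv (seq int) n is Some s then
    if s \in [set s | exit_word c k s] then (F s * \1_(cylinder k s) x)%:E else 0%E
  else 0%E.

Let term_ge0 c F n x : (forall s, 0 <= F s) -> (0 <= term c F n x)%E.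
Proof.
move=> F0; rewrite /term; case: (pickle_inv n) => // s; case: ifP => // _.
by rewrite lee_fin mulr_ge0.
Qed.

Let transfer_funE c F : (forall s, 0 <= F s) ->
  transfer_fun c F = (fun x => \sum_(n <oo) term c F n x)%E.
Proof.
move=> F0; apply/funext => x; rewrite /transfer_fun esum_pickle//.
by move=> s; rewrite lee_fin mulr_ge0.
Qed.

Let measurable_term c F n : measurable_fun [set: paths] (term c F n).
Proof.
rewrite /term; case: (pickle_inv n) => [s|]; last exact: measurable_cst.
case: (s \in _); last exact: measurable_cst.
apply/measurable_EFinP; apply: measurable_funM; first exact: measurable_cst.
by apply: measurable_indic; exact: measurable_cylinder.
Qed.

Lemma measurable_transfer_fun c F : (forall s, 0 <= F s) ->
  measurable_fun [set: paths] (transfer_fun c F).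
Proof.
move=> F0; rewrite transfer_funE//.
apply: (@ge0_emeasurable_sum _ _ _ setT (term c F) xpredT) => //.
by move=> n x _ _; exact: term_ge0.
Qed.

Lemma integral_transfer_fun c F : (forall s, 0 <= F s) ->
  (\int[Q]_x transfer_fun c F x =
   \esum_(s in [set s | exit_word c k s]) (F s * wt w k s)%:E)%E.
Proof.
move=> F0; rewrite transfer_funE// integral_nneseries//; last first.
  by move=> n x _; exact: term_ge0.
rewrite esum_pickle; last by move=> s; rewrite lee_fin mulr_ge0// wt_ge0.
apply: eq_eseriesr => n _; rewrite /term.
case: (pickle_inv n) => [s|]; last by rewrite integral0.
case: ifP => _; last by rewrite integral0.
under eq_integral do rewrite EFinM.
have mI : measurable_fun [set: paths] (fun x => (\1_(cylinder k s) x : R)%:E).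
  by apply/measurable_EFinP; apply: measurable_indic; exact: measurable_cylinder.
rewrite ge0_integralZl_EFin//.
rewrite integral_indic ?setIT//; last exact: measurable_cylinder.
by have := walk_law_cylinder s => /= ->.
Qed.

(** Proper paths have full measure, so [f] agrees almost everywhere with [transfer_fun c F], and
    each cylinder integrates to the weight of its word. *)
Lemma integral_exit c (f : paths -> \bar R) (F : seq int -> R) :
  measurable_fun [set: paths] f -> (forall x, 0 <= f x)%E -> (forall s, 0 <= F s) ->
  (forall x N, proper_path x -> exits c x N -> f x = (F (path_word x N))%:E) ->
  {ae Q, forall x, (forall N, ~ exits c x N) -> f x = 0%E} ->
  (\int[Q]_x f x =
   \esum_(s in [set s | exit_word c k s]) (F s * wt w k s)%:E)%E.
Proof.
move=> mf f0 F0 fF f_noexit; rewrite -integral_transfer_fun//.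
apply: ge0_ae_eq_integral => //.
- exact: measurable_transfer_fun.
- by move=> x _; exact: transfer_fun_ge0.
have FF := ae_filter_ringOfSetsType Q.
apply: (filterS2 _ _ proper_ae f_noexit) => x px fx _.
have [[N xN]|/forallNP xN] := pselect (exists N, exits c x N).
  by rewrite (transfer_fun_exit F0 px xN) (fF _ _ px xN).
by rewrite fx// transfer_fun_noexit.
Qed.

End walk_law.

(** * Hitting time and crossing counts *)

(** Padding the first [n] coordinates with zeros gives a path that agrees with [x] before time [n],
    so [A] is an event about this prefix. *)
Lemma measurable_horizon n (A : set paths) :
  (forall x y : paths, (forall m, (m < n)%N -> x m = y m) -> A x -> A y) ->
  measurable A.
Proof.
move=> HA; rewrite (_ : A = [set x : paths | A (nth 0 (mkseq x n))]).
  exact: (measurable_prefix n [set s | A (nth 0 s)]).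
by apply/seteqP; split=> x; apply: HA => m mn; rewrite nth_mkseq.
Qed.

Lemma row3E (T : Type) (a b c : T) l : row3 a b c ord0 l = tnth [tuple a; b; c] l.
Proof. by rewrite mxE. Qed.

Section hitting.
Context {R : realType}.
Implicit Types x : paths.

Lemma lt_T1P x n :
  (n%:R%:E < T1 R x)%E <-> forall m, (0 < m <= n)%N -> x m <= 0.
Proof.
split=> [nT m /andP[m0 mn]|H].
  rewrite leNgt; apply/negP => xm.
  have : (T1 R x <= m%:R%:E)%E by apply: ereal_inf_lbound; exists m.
  by apply/negP; rewrite -ltNge (le_lt_trans _ nT)// lee_fin ler_nat.
apply: (@lt_le_trans _ _ n.+1%:R%:E); first by rewrite lte_fin ltr_nat.
apply: le_ereal_inf_tmp => _ [m [m0 xm] <-]; rewrite lee_fin ler_nat ltnNge.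
by apply/negP => mn; have := H m; rewrite m0 mn => /(_ isT); lia.
Qed.

Lemma T1_exit x N : x 0%N = 0 -> exits 0 x N -> T1 R x = N%:R%:E.
Proof.
move=> x0 [xN HN]; case: N xN HN => [|N] xN HN; first by rewrite x0 in xN.
apply/eqP; rewrite eq_le; apply/andP; split.
  by apply: ereal_inf_lbound; exists N.+1.
apply: le_ereal_inf_tmp => _ [m [m0 xm] <-]; rewrite lee_fin ler_nat leqNgt.
by apply/negP => mN; have := HN m mN; lia.
Qed.

Lemma measurable_T1 : measurable_fun [set: paths] (T1 R).
Proof.
apply: (measurability _ (ErealGenInftyO.measurableE R)) => // _ [_ [r ->] <-].
rewrite setTI (_ : _ @^-1` _ = \bigcup_n
   [set x : paths | (0 < n)%N /\ (0 < x n /\ (n%:R < r)%R)]).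
  apply: bigcupT_measurable => n; apply: (@measurable_horizon n.+1) => x y xy /=.
  by rewrite xy.
apply/seteqP; split=> x /=; rewrite in_itv /=.
  move=> /ereal_inf_lt[_ [n [n0 xn] <-]]; rewrite lte_fin => nr.
  by exists n.
move=> [n _ [n0 [xn nr]]]; apply: le_lt_trans (_ : (n%:R%:E < r%:E)%E).
  by apply: ereal_inf_lbound; exists n.
by rewrite lte_fin.
Qed.

Lemma T1_ge0 x : (0 <= T1 R x)%E.
Proof. by apply: le_ereal_inf_tmp => _ [n _ <-]; rewrite lee_fin. Qed.

Lemma measurable_crossing_step i a b n :
  measurable [set x : paths | crossing_step R x i a b n].
Proof.
rewrite (_ : [set _ | _] = \bigcup_m [set x : paths |
   (forall l, (0 < l <= n)%N -> x l <= 0) /\ x n = i /\ x n.+1 = i - 1 /\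
   (n < m)%N /\ (forall j, (n < j <= m)%N -> x j < i) /\
            i <= x m.+1 /\ x m = a /\ x m.+1 = b]).
  apply: bigcupT_measurable => m.
  apply: (@measurable_horizon (maxn n.+2 m.+2)) => x y xy /=.
  move=> [H1 [H2 [H3 [nm [H4 [H5 [H6 H7]]]]]]].
  rewrite -!xy ?leq_max ?ltnSn ?orbT//; try lia.
  split; first by move=> l ln; rewrite -xy ?H1//; lia.
  do 3 split => //; split => //; by move=> j jm; rewrite -xy ?H4//; lia.
apply/seteqP; split=> x /=.
  by move=> [/lt_T1P H1 [H2 [H3 [m H4]]]]; exists m.
move=> [m _ [H1 [H2 [H3 H4]]]]; split; first exact/lt_T1P.
by do 2 split => //; exists m.
Qed.

Lemma measurable_counting (S : paths -> set nat) :
  (forall n, measurable [set x | S x n]) ->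
  measurable_fun [set: paths] (fun x => counting (S x) : \bar R).
Proof.
move=> mS.
rewrite (_ : (fun _ => _) = (fun x => \sum_(n <oo) (\1_[set x | S x n] x : R)%:E)%E).
  apply: (@ge0_emeasurable_sum _ _ _ setT (fun n x => (\1_[set x | S x n] x)%:E)
    xpredT) => //.
  - by move=> n _; apply/measurable_EFinP; exact: measurable_indic.
apply/funext => x; rewrite counting_dirac; apply: eq_eseriesr => n _.
by rewrite diracE indicE; congr ((_ : bool)%:R%:E); apply/idP/idP; rewrite !inE.
Qed.

Lemma measurable_last_jump a b : measurable [set x : paths | last_jump R x a b].
Proof.
rewrite (_ : [set _ | _] = \bigcup_n ([set x : paths | T1 R x = n.+1%:R%:E] `&`
   [set x : paths | x n = a /\ x n.+1 = b])).
  apply: bigcupT_measurable => n; apply: measurableI.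
    rewrite -[X in measurable X]setTI.
    exact: (measurable_T1 measurableT (emeasurable_set1 n.+1%:R%:E)).
  by apply: (@measurable_horizon n.+2) => x y xy /=; rewrite !xy.
apply/seteqP; split=> x /=; first by move=> [n [? ?]]; exists n.
by move=> [n _ [? ?]]; exists n.
Qed.

Lemma measurable_U i l : measurable_fun [set: paths] (fun x => U R x i ord0 l).
Proof.
have mI a b : measurable_fun [set: paths] (fun x => (`[< last_jump R x a b
  >])%:R%:E : \bar R).
  rewrite (_ : (fun _ => _) = (fun x => (\1_[set x | last_jump R x a b] x)%:E)).
    by apply/measurable_EFinP; apply: measurable_indic; exact: measurable_last_jump.
  apply/funext => x; rewrite indicE.
  have -> : (x \in [set x | last_jump R x a b]) = `[< last_jump R x a b >].
    by apply/idP/asboolP; rewrite inE.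
  by [].
rewrite /U; case: (i <= 0).
  apply: (eq_measurable_fun (fun x : paths =>
    tnth [tuple cntA R x i; cntB R x i; cntC R x i] l)) => [x _|].
    by rewrite row3E.
  case: l => -[|[|[|//]]] ?;
    by apply: measurable_counting => n; exact: measurable_crossing_step.
apply: (eq_measurable_fun (fun x : paths => tnth
  [tuple (`[< last_jump R x 0 1 >])%:R%:E; (`[< last_jump R x (-1) 1 >])%:R%:E;
         (`[< last_jump R x 0 2 >])%:R%:E] l)) => [x _|]; first by rewrite row3E.
by case: l => -[|[|[|//]]] ?; exact: mI.
Qed.

Lemma U_ge0 x i l : (0 <= U R x i ord0 l)%E.
Proof.
rewrite /U; case: (i <= 0); rewrite row3E; case: l => -[|[|[|//]]] ? /=.
all: by rewrite ?lee_fin ?ler0n// /cntA /cntB /cntC measure_ge0.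
Qed.

Lemma jumps_path_word a b x N : jumps a b (x 0%N) (path_word x N) =
  (\sum_(n < N) ((x n == a)%R && (x n.+1 == b)%R))%N.
Proof.
elim: N x => [|N IH] x; first by rewrite big_ord0.
rewrite path_word_cons big_ord_recl /= (addrC (x 0%N)) subrK; congr (_ + _)%N.
exact: (IH (x \o succn)).
Qed.

Lemma counting_ord (S : set nat) N : S `<=` `I_N ->
  counting S = (\sum_(n < N) `[< S n >])%N%:R%:E :> \bar R.
Proof.
move=> SN; rewrite counting_dirac nneseries_esumT//.
transitivity (\esum_(n in S) (1 : \bar R))%E.
  rewrite [RHS]esum_mkcond; apply: eq_esum => n _.
  by rewrite diracE; case: (n \in S).
have SE : S = [set n | (n < N)%N && `[< S n >]].
  by apply/seteqP; split=> n /= => [Sn|/andP[_ /asboolP]//]; rewrite SN//;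
    apply/asboolP.
rewrite {1}SE (esum_ord N (fun n => `[< S n >]))// big_mkcond natr_sum -sumEFin.
by apply: eq_bigr => n _; case: `[< _ >].
Qed.

(* Going backwards in time, a crossing step at [n] is paid for by the jump that
   completes it; [ret n] records a jump still to come. *)
Lemma crossing_jumps x N i a b : proper_path 0 x -> exits 0 x N ->
  i <= 0 -> a < i -> i <= b ->
  counting [set n | crossing_step R x i a b n] =
    (jumps a b 0 (path_word x N))%:R%:E :> \bar R.
Proof.
move=> [x0 px] xN i0 ai ib; have TN := T1_exit x0 xN.
rewrite (@counting_ord _ N); last first.
  by move=> n [+ _] /=; rewrite TN lte_fin ltr_nat.
have := jumps_path_word a b x N; rewrite x0 => ->; congr (_%:R%:E).
pose ret n := exists m, (n <= m)%N /\ (forall j, (n <= j <= m)%N -> x j < i) /\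
   x m = a /\ x m.+1 = b.
(* Below [i] no crossing step starts, and a pending return is either the jump made at [n] or still
   pending at [n.+1]. At or above [i] nothing is pending and the jump does not start at [a < i]; a
   crossing step at [n] then amounts to a pending return at [n.+1], since the only way below [i] is
   the step from [i] to [i - 1]. *)
have key n : (n < N)%N -> (`[< crossing_step R x i a b n >] + `[< ret n >])%N =
    (((x n == a) && (x n.+1 == b))%R + `[< ret n.+1 >])%N.
  move=> nN; have nT : (n%:R%:E < T1 R x)%E by rewrite TN lte_fin ltr_nat.
  have [xi|xi] := ltP (x n) i.
    rewrite asboolF; last by move=> [_ []]; lia.
    have [/andP[/eqP xa /eqP xb]|xab] := boolP ((x n == a) && (x n.+1 == b)).
      rewrite asboolT; last first.
        by exists n; do 2 split => //; move=> j; rewrite -eqn_leq => /eqP <-.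
      rewrite asboolF// => -[m [nm [H _]]]; have := H n.+1; rewrite xb leqnn nm.
      by move/(_ isT); lia.
    congr nat_of_bool; apply/asboolP/asboolP.
      move=> [m [nm [H [xm xm1]]]]; exists m; split.
        rewrite ltn_neqAle nm andbT; apply/eqP => nm'; move/negP: xab; apply.
        by rewrite nm' xm xm1 !eqxx.
      by split=> // j /andP[nj jm]; apply: H; rewrite jm andbT ltnW.
    move=> [m [nm [H xm]]]; exists m; split; first exact: ltnW.
    split=> // j /andP[]; rewrite leq_eqVlt => /predU1P[<-//|nj jm].
    by apply: H; rewrite nj.
  rewrite (_ : `[< ret n >] = false) ?addn0; last first.
    by apply/asboolP => -[m [nm [H _]]]; have := H n; rewrite leqnn nm => /(_ isT); lia.
  rewrite (_ : (x n == a) = false) /=; last by apply/eqP; lia.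
  congr nat_of_bool; apply/asboolP/asboolP.
    by move=> [_ [_ [_ [m [nm [H [_ xm]]]]]]]; exists m.
  move=> [m [nm [H [xm xm1]]]].
  have xn1 : x n.+1 < i by apply: H; rewrite leqnn nm.
  have sn := stepP _ (px n); split => //; split; first by case: sn; lia.
  split; first by case: sn; lia.
  by exists m; do 2 split => //; rewrite xm1.
(* Both boundary terms vanish because the path starts and ends at or above [i], so the balance over
   all times telescopes to the claim. *)
have rN : ~ ret N.
  move=> [m [Nm [H _]]]; have := H N; rewrite leqnn Nm => /(_ isT).
  by have := xN.1; lia.
have r0 : ~ ret 0%N by move=> [m [_ [H _]]]; have := H 0%N isT; lia.
suff: forall d, (d <= N)%N ->
   (\sum_(N - d <= n < N) `[< crossing_step R x i a b n >] + `[< ret (N - d)%N >])%N =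
   (\sum_(N - d <= n < N) ((x n == a)%R && (x n.+1 == b)%R))%N.
  move/(_ N (leqnn N)); rewrite subnn (asboolF r0) addn0 !big_mkord => <-//.
elim=> [_|d IH dN]; first by rewrite subn0 !big_geq// asboolF.
have E : (N - d)%N = (N - d.+1).+1 by lia.
have lt : (N - d.+1 < N)%N by lia.
rewrite !(big_ltn lt) -E -IH; last lia.
have := key _ lt; rewrite -E => e; lia.
Qed.

(** At [i = 1] the same three counts describe the jump that ends an exit word, so the convention for
    [U(1)] becomes an instance of the general formula. *)
Definition Ucount (i : int) (s : seq int) : 3.-tuple nat :=
  [tuple jumps (i - 1) i 0 s; jumps (i - 2) i 0 s; jumps (i - 1) (i + 1) 0 s].

(** The position is at most 0 until the exit time, so only the final jump can land at [b > 0], and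
    its count is 0 or 1. *)
Lemma last_jump_exit x N a b : proper_path 0 x -> exits 0 x N -> 0 < b ->
  `[< last_jump R x a b >] = jumps a b 0 (path_word x N) :> nat.
Proof.
move=> [x0 px] xN b0; have TN := T1_exit x0 xN.
have := jumps_path_word a b x N; rewrite x0 => ->.
case: N xN TN => [|N] xN TN; first by case: xN; rewrite x0.
rewrite big_ord_recr /= big1 => [|n _]; last first.
  apply/eqP; rewrite eqb0; apply/negP => /andP[_ /eqP xb].
  by have := xN.2 n.+1; rewrite ltnS ltn_ord => /(_ isT); lia.
rewrite add0n; congr nat_of_bool; apply/asboolP/andP.
  move=> [n []]; rewrite TN => -[] /eqP; rewrite eqr_nat => /eqP[<-].
  by move=> [-> ->]; rewrite !eqxx.
by move=> [/eqP xa /eqP xb]; exists N.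
Qed.

Lemma U_exit x N i l : proper_path 0 x -> exits 0 x N -> i <= 1 ->
  U R x i ord0 l = (tnth (Ucount i (path_word x N)) l)%:R%:E.
Proof.
move=> px xN i1; rewrite /U; case: (leP i 0) => i0; rewrite row3E.
  case: l => -[|[|[|//]]] ? /=; apply: crossing_jumps => //; lia.
have -> : i = 1 by lia.
by case: l => -[|[|[|//]]] ?;
  rewrite !(tnth_nth 0%E) (tnth_nth 0%N) /= (last_jump_exit _ px xN).
Qed.

End hitting.

(** * Exit probabilities *)

Lemma exit_word_gt c k s : c < k -> exit_word c k s -> s = [::].
Proof. by case: s => [//|z s] /= ck /andP[kc]; lia. Qed.

(** Only the last jump lands above [c]: at [c + 1] it comes from [c] or [c - 1], at [c + 2] only
    from [c]. *)
Lemma exit_word_pos c k s : k <= c -> exit_word c k s ->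
  (pos k s == c + 1) = (jumps c (c + 1) k s + jumps (c - 1) (c + 1) k s)%N :> nat /\
  (pos k s == c + 2) = jumps c (c + 2) k s :> nat.
Proof.
elim: s k => [|z s IH] k kc /=; first by rewrite ltNge kc.
move=> /and3P[_ /stepP sz es]; have [le|gt] := leP (k + z) c.
  have [-> ->] := IH _ le es.
  by case: sz le => -> le; split; lia.
by rewrite (exit_word_gt gt es) /=; case: sz gt => -> gt; split; lia.
Qed.

Lemma jumps_exit_word0 a b c k s : exit_word c k s -> c < a -> jumps a b k s = 0%N.
Proof.
move=> + ca; elim: s k => [//|z s IH] k /= /and3P[kc _ /IH ->].
by case: eqP => //=; lia.
Qed.

Lemma exit_word_excise t l i a v : word 0 0 i t -> word (i - 1) (i - 1) a l ->
  step (i - a) ->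
  exit_word 0 0 (t ++ -1 :: l ++ (i - a) :: v) = exit_word 0 0 (t ++ v).
Proof.
move=> wt wl si; have i0 := word_le_end wt; have ai := word_le_end wl.
rewrite !exit_word_cat (word_pos wt) ?wt//= exit_word_cat (word_pos wl); last lia.
rewrite i0 /= (word_widen _ wl) ?si; last lia.
by rewrite addrC subrK /=; case: leP => //; lia.
Qed.

(** The loop from [i] back to [i] never rises above [i]. In particular it contains no jump counted
    by [U(i + 1)], whose targets are [i + 1] and [i + 2]. *)
Lemma jumps_excise t l i a v b c : word 0 0 i t -> word (i - 1) (i - 1) a l -> i < c ->
  jumps b c 0 (t ++ -1 :: l ++ (i - a) :: v) = jumps b c 0 (t ++ v).
Proof.
move=> wt wl ic; have i0 := word_le_end wt; have ai := word_le_end wl.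
rewrite !jumps_cat (word_pos wt) /= jumps_cat (word_pos wl) /= (jumps_word0 _
  wl); last lia.
by rewrite (addrC a) subrK; lia.
Qed.

(** Arrivals at [i] from above, together with the start if [i = 0], are as numerous as the upward
    crossings out of [(-oo, i]], and these are exactly the particles of [U(i + 1)]. *)
Lemma visits_Ucount i s : i <= 0 -> exit_word 0 0 s ->
  visits i 0 s = (tnth (Ucount i s) 0%R + tnth (Ucount i s) 1%R +
                  \sum_(l < 3) tnth (Ucount (i + 1) s) l)%N.
Proof.
move=> i0 es; have := visits_exit_word i0 es; have := upcross_exit_word i0 es.
rewrite !big_ord_recl big_ord0 !(tnth_nth 0%N) /= addrK.
have -> : i + 1 - 2 = i - 1 by lia.
have -> : i + 1 + 1 = i + 2 by lia.
have e : ((0 == i)%R + (i < 0)%R)%N = 1%N by lia.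
move: (jumps i (i + 1) 0 s) (jumps (i - 1) (i + 1) 0 s) (jumps i (i + 2) 0 s) => a b c.
move: (jumps (i + 1) i 0 s) (jumps (i - 1) i 0 s) (jumps (i - 2) i 0 s) (visits i
  0 s) => f g h v.
lia.
Qed.

Lemma Ucount2 i s : tnth (Ucount i s) ord_max = tnth (Ucount (i + 1) s) 1.
Proof. by rewrite !(tnth_nth 0%N) /=; congr jumps; lia. Qed.

Section quenched.
Context {R : realType} (Pw : env R -> int -> probability paths R) (w : env R).
Hypothesis hPw : forall k, is_walk_law w k (Pw w k).
Hypothesis jq_gt0 : forall k : int, k <= 0 -> 0 < jq (w k).
Hypothesis jp1_gt0 : forall k : int, k <= 0 -> 0 < jp1 (w k).
Hypothesis jp2_gt0 : forall k : int, k <= 0 -> 0 < jp2 (w k).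

Local Notation wt := (wt w).
Local Notation mass := (mass w).

Lemma measurable_exits c : measurable [set x : paths | exists N, exits c x N].
Proof.
rewrite (_ : [set _ | _] = \bigcup_N [set x : paths | exits c x N]).
  apply: bigcupT_measurable => N; apply: (@measurable_horizon N.+1) => x y xy [xN HN].
  by split=> [|m mN]; rewrite -xy ?HN// ltnS ltnW.
by apply/seteqP; split=> x /=; [move=> [N xN]; exists N|move=> [N _ xN]; exists N].
Qed.

Lemma esum_exit_prob c k :
  (\esum_(s in [set s | exit_word c k s]) (wt k s)%:E =
   Pw w k [set x | exists N, exits c x N])%E.
Proof.
have mE := measurable_exits c.
transitivity (\int[Pw w k]_x (\1_[set x : paths | exists N, exits c x N] x : R)%:E)%E.
  rewrite (integral_exit (hPw k) (c := c) (F := fun=> 1))//.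
  - by apply: eq_esum => s _; rewrite mul1r.
  - by apply/measurable_EFinP; exact: measurable_indic.
  - by move=> x N _ xN; rewrite indicE mem_set//=; exists N.
  - apply: aeW => x xN; rewrite indicE memNset//= => -[N]; exact: xN.
by rewrite integral_indic ?setIT.
Qed.

Lemma esum_exit_le1 c k :
  (\esum_(s in [set s | exit_word c k s]) (wt k s)%:E <= 1)%E.
Proof. by rewrite esum_exit_prob; apply: probability_le1; exact: measurable_exits. Qed.

(** A jump above [c] ends the word, so nothing follows the marked jump, and its prefix ranges over
    all words from [k] to [a] below the ceiling [c]. *)
Lemma esum_exit_jump c k a b : a <= c -> c < b -> step (b - a) ->
  (\esum_(s in [set s | exit_word c k s]) ((jumps a b k s)%:R%:E * (wt k s)%:E) =
   mass c k a * (trans w a b)%:E)%E.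
Proof.
move=> ac cb sba; rewrite (esum_jumps _ (c := c))//; last by move=> s; exact: wtE_ge0.
rewrite muleC /mass -esumZl; last 2 first.
- by rewrite lee_fin trans_ge0.
- by move=> s; exact: wtE_ge0.
apply: eq_esum => u /= wu.
rewrite (_ : [set v | _] = [set [::]]).
  rewrite esum_set1 ?wtE_ge0// wt_cat (word_pos wu) /= mulr1 (addrC a) subrK.
  by rewrite EFinM muleC.
apply/seteqP; split=> v /=;
  rewrite exit_word_cat (word_pos wu)//= wu ac sba /= (addrC a) subrK.
  exact: exit_word_gt.
by move=> ->.
Qed.

Lemma esum_exit_prob_pos (k j : int) : 0 < j ->
  (\esum_(s in [set s | exit_word k k s]) ((pos k s == k + j)%:R * wt k s)%:E =
   Pw w k [set x : paths | exists n, x n = (k + j)%R /\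
                                 forall m, (m < n)%N -> (x m < k + 1)%R])%E.
Proof.
move=> j0; set A := [set x : paths | _].
have AE (x : paths) N : proper_path k x -> exits k x N -> A x <-> pos k
  (path_word x N) = k + j.
  move=> [x0 _] xN; have := pos_path_word x N; rewrite x0 => ->;
    split=> [[n [xn Hn]]|xNj].
    have nN : n = N; last by rewrite -nN.
    apply: exits_inj xN; split; first by rewrite xn; lia.
    by move=> m /Hn; lia.
  by exists N; split => // m /(xN.2 m); lia.
have mA : measurable A.
  rewrite (_ : A = \bigcup_n [set x : paths | x n = k + j /\
                                 forall m, (m < n)%N -> x m < k + 1]).
    apply: bigcupT_measurable => n; apply: (@measurable_horizon n.+1) => x y xy [xn Hn].
    by split=> [|m mn]; rewrite -xy ?Hn// ltnS ltnW.
  by apply/seteqP; split=> x /=; [move=> [n xn]; exists n|move=> [n _ xn]; exists n].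
rewrite -(integral_exit (hPw k) (c := k) (f := fun x => (\1_A x)%:E)
    (F := fun s => (pos k s == k + j)%:R))//.
- by rewrite integral_indic ?setIT.
- by apply/measurable_EFinP; exact: measurable_indic.
- move=> x N px xN; rewrite indicE; congr (_ %:R%:E).
  have := AE _ _ px xN; case: eqP => h [h1 h2]; first by rewrite mem_set//; exact: h2.
  by rewrite memNset// => /h1.
- apply: aeW => x xN; rewrite indicE memNset//= => -[n [xn Hn]].
  by apply: (xN n); split => [|m /Hn]; lia.
Qed.

Lemma exit_prob2 k : k <= 0 ->
  (mass k k k * (jp2 (w k))%:E = (exit_prob Pw w k 2)%:E)%E.
Proof.
move=> k0; rewrite /exit_prob -esum_exit_prob_pos//.
rewrite -trans_up2 -esum_exit_jump//; [|lia|by rewrite addrC addKr].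
have -> : (\esum_(s in [set s | exit_word k k s]) ((pos k s == k + 2)%:R * wt k s)%:E =
  \esum_(s in [set s | exit_word k k s]) ((jumps k (k + 2)%R k s)%:R%:E * (wt k
    s)%:E))%E.
  by apply: eq_esum => s /= es; rewrite (exit_word_pos (lexx k) es).2 EFinM.
(* Since [fine] sends infinity to 0, finiteness has to be shown; the sum is at most the total exit
   probability. *)
rewrite fineK// ge0_fin_numE; last by apply: esum_ge0 => s _;
  rewrite mule_ge0 ?wtE_ge0// lee_fin.
apply: le_lt_trans (ltry 1); apply: le_trans (esum_exit_le1 k k).
apply: le_esum => s /= es; rewrite -(exit_word_pos (lexx k) es).2 -EFinM lee_fin.
by rewrite ler_piMl ?wt_ge0// (ler_nat _ _ 1) leq_b1.
Qed.

Definition green (k : int) : R := fine (mass k k k).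

Lemma green_ge0 k : 0 <= green k.
Proof. by rewrite fine_ge0// mass_ge0. Qed.

(** An infinite Green function times the positive [jp2 (w k)] would be infinite, whereas by
    [exit_prob2] this product is a real exit probability. *)
Lemma massE k : k <= 0 -> mass k k k = (green k)%:E.
Proof.
move=> k0; rewrite fineK//; have := exit_prob2 k0; have := mass_ge0 w k k k.
have := jp2_gt0 k0; case: (mass k k k) => [//| |//] p0 _.
by rewrite gt0_mulye ?lte_fin.
Qed.

Lemma exit_prob2E k : k <= 0 -> exit_prob Pw w k 2 = green k * jp2 (w k).
Proof. by move=> k0; have := exit_prob2 k0; rewrite massE// -EFinM => -[]. Qed.

Lemma gammaE i : i <= 0 -> gamma Pw w i = jq (w i) * (green (i - 1) * jp2 (w (i - 1))).
Proof. by move=> i0; rewrite /gamma exit_prob2E//; lia. Qed.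

Lemma gamma_ge0 i : i <= 0 -> 0 <= gamma Pw w i.
Proof. by move=> i0; rewrite gammaE// !mulr_ge0 ?green_ge0 ?jq_ge0 ?jp2_ge0. Qed.

Lemma mass_down1 c k i : i <= 0 -> i <= k ->
  mass c k (i - 1) = (mass c k i * (jq (w i) * green (i - 1))%:E)%E.
Proof.
by move=> i0 ik; rewrite (@mass_last_exit _ w c k i (i - 1))// ?massE//; lia.
Qed.

(** Exit at [k + 1] is a jump by 1 from [k] or by 2 from [k - 1]; reaching [k - 1] costs a further
    factor [jq (w k) * green (k - 1)], which with [jp2 (w (k - 1))] makes up [gamma]. *)
Lemma exit_prob1E k : k <= 0 ->
  exit_prob Pw w k 1 = green k * (jp1 (w k) + gamma Pw w k).
Proof.
move=> k0; rewrite /exit_prob -esum_exit_prob_pos//.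
rewrite (_ : esum _ _ =
  \esum_(s in [set s | exit_word k k s]) ((jumps k (k + 1)%R k s)%:R%:E * (wt k s)%:E +
     (jumps (k - 1)%R (k + 1)%R k s)%:R%:E * (wt k s)%:E))%E; last first.
  apply: eq_esum => s /= es; rewrite (exit_word_pos (lexx k) es).1 EFinM natrD EFinD.
  by rewrite ge0_muleDl ?lee_fin.
rewrite esumD; last 2 first.
- by move=> s _; rewrite mule_ge0 ?wtE_ge0// lee_fin.
- by move=> s _; rewrite mule_ge0 ?wtE_ge0// lee_fin.
have s1 : step (k + 1 - k) by rewrite (_ : k + 1 - k = 1)//; lia.
have s2 : step (k + 1 - (k - 1)) by rewrite (_ : k + 1 - (k - 1) = 2)//; lia.
rewrite !esum_exit_jump//; try lia.
have -> : trans w (k - 1) (k + 1) = jp2 (w (k - 1)).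
  by rewrite -trans_up2; congr trans; lia.
by rewrite mass_down1// massE// trans_up1 -!EFinM -EFinD /= gammaE//; ring.
Qed.

Lemma exit_prob12_le1 k : k <= 0 -> exit_prob Pw w k 1 + exit_prob Pw w k 2 <= 1.
Proof.
move=> k0.
have fin j : 0 < j -> (exit_prob Pw w k j)%:E =
  (\esum_(s in [set s | exit_word k k s]) ((pos k s == k + j)%:R * wt k s)%:E)%E.
  move=> j0; rewrite /exit_prob -esum_exit_prob_pos// fineK// ge0_fin_numE.
    apply: le_lt_trans (ltry 1); apply: le_trans (esum_exit_le1 k k).
    by apply: le_esum => s _; rewrite lee_fin ler_piMl ?wt_ge0// (ler_nat _ _ 1) leq_b1.
  by apply: esum_ge0 => s _; rewrite lee_fin mulr_ge0 ?wt_ge0.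
rewrite -lee_fin EFinD !fin// -esumD; last 2 first.
- by move=> s _; rewrite lee_fin mulr_ge0 ?wt_ge0.
- by move=> s _; rewrite lee_fin mulr_ge0 ?wt_ge0.
apply: le_trans (esum_exit_le1 k k); apply: le_esum => s _.
rewrite -EFinD -mulrDl -natrD lee_fin ler_piMl ?wt_ge0// (ler_nat _ _ 1).
by case: eqP => [->|_]; case: eqP => //=; lia.
Qed.

Lemma jp1_gamma_gt0 k : k <= 0 -> 0 < jp1 (w k) + gamma Pw w k.
Proof. by move=> k0; rewrite ltr_pwDl ?jp1_gt0 ?gamma_ge0. Qed.

(** The denominator in [alpha] cancels by [exit_prob1E]; what is left is the weight of all loops at
    [i] that go below [i] and return by a jump from [i - 1]. *)
Lemma alphaE i : i <= 0 -> alpha Pw w i = jq (w i) * green (i - 1) * jp1 (w (i - 1)).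
Proof.
move=> i0; have i1 : i - 1 <= 0 by lia.
rewrite /alpha exit_prob1E//; have := jp1_gamma_gt0 i1 => /lt0r_neq0 h; field; exact: h.
Qed.

(** Likewise the weight of the loops at [i] closed by a jump from [i - 2], the factor [gamma]
    containing the further descent to [i - 2]. *)
Lemma betaE i : i <= 0 -> beta Pw w i = jq (w i) * green (i - 1) * gamma Pw w (i - 1).
Proof.
move=> i0; have i1 : i - 1 <= 0 by lia.
rewrite /beta exit_prob1E//; have := jp1_gamma_gt0 i1 => /lt0r_neq0 h; field; exact: h.
Qed.

Lemma alpha_ge0 i : i <= 0 -> 0 <= alpha Pw w i.
Proof. by move=> i0; rewrite alphaE// !mulr_ge0 ?green_ge0 ?jq_ge0 ?jp1_ge0. Qed.

Lemma beta_ge0 i : i <= 0 -> 0 <= beta Pw w i.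
Proof.
move=> i0; have i1 : i - 1 <= 0 by lia.
rewrite betaE//; apply: mulr_ge0; last exact: gamma_ge0.
by rewrite mulr_ge0 ?green_ge0 ?jq_ge0.
Qed.

(** By [exit_prob1E] the sum of [alpha] and [beta] is [jq (w i)] times an exit probability, and
    [jq (w i) < 1] because upward jumps have positive probability. *)
Lemma alpha_beta_lt1 i : i <= 0 -> 0 < 1 - alpha Pw w i - beta Pw w i.
Proof.
move=> i0; have i1 : i - 1 <= 0 by lia.
have e : alpha Pw w i + beta Pw w i = jq (w i) * exit_prob Pw w (i - 1) 1.
  by rewrite alphaE// betaE// exit_prob1E//; ring.
have e1 : exit_prob Pw w (i - 1) 1 <= 1.
  apply: le_trans (exit_prob12_le1 i1); rewrite lerDl exit_prob2E//.
  by rewrite mulr_ge0 ?green_ge0 ?jp2_ge0.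
have := jsum1 (w i); have := jp1_gt0 i0; have := jp2_gt0 i0.
have : jq (w i) * exit_prob Pw w (i - 1) 1 <= jq (w i) by rewrite ler_piMr ?jq_ge0.
lra.
Qed.

End quenched.

(** * Mean counts *)

(** The only trace of dependence on [U(i + 1)] alone that excision needs: inserting or removing a
    loop below [i] does not affect membership. *)
Definition excisable (i : int) (K : set (seq int)) : Prop :=
  K `<=` [set s | exit_word 0 0 s] /\
  forall a t l v, word 0 0 i t -> word (i - 1) (i - 1) a l -> step (i - a) ->
    K (t ++ -1 :: l ++ (i - a) :: v) <-> K (t ++ v).

Lemma excisable_exit_word i : excisable i [set s | exit_word 0 0 s].
Proof.
by split=> // a t l v wt wl si; rewrite /= (exit_word_excise v wt wl si).
Qed.

Lemma excisable_Ucount i (c : 'I_3 -> nat) : excisable i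
  [set s | exit_word 0 0 s /\ forall l, tnth (Ucount (i + 1) s) l = c l].
Proof.
split=> [s []//|a t l v wt wl si] /=; rewrite (exit_word_excise v wt wl si).
have -> // : Ucount (i + 1) (t ++ -1 :: l ++ (i - a) :: v) = Ucount (i + 1) (t ++ v).
by apply: val_inj; rewrite /= !(jumps_excise _ _ wt wl)//; lia.
Qed.

Section quenched.
Context {R : realType} (Pw : env R -> int -> probability paths R) (w : env R).
Hypothesis hPw : forall k, is_walk_law w k (Pw w k).
Hypothesis jq_gt0 : forall k : int, k <= 0 -> 0 < jq (w k).
Hypothesis jp1_gt0 : forall k : int, k <= 0 -> 0 < jp1 (w k).
Hypothesis jp2_gt0 : forall k : int, k <= 0 -> 0 < jp2 (w k).

Local Notation wt := (wt w).
Local Notation mass := (mass w).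
Local Notation green := (green w).
Local Notation alpha := (alpha Pw w).
Local Notation beta := (beta Pw w).
Local Notation gamma := (gamma Pw w).

Definition mean_count (K : set (seq int)) (i : int) (l : 'I_3) : \bar R :=
  (\esum_(s in K) ((tnth (Ucount i s) l)%:R%:E * (wt 0 s)%:E))%E.

Arguments mean_count K i%_R l%_R.

Definition mean_visits (K : set (seq int)) (i : int) : \bar R :=
  (\esum_(s in K) ((visits i 0 s)%:R%:E * (wt 0 s)%:E))%E.

Lemma nat_wt_ge0 n k s : (0 <= n%:R%:E * (wt k s)%:E)%E.
Proof. by rewrite mule_ge0 ?wtE_ge0// lee_fin. Qed.

Lemma mean_count_ge0 K i l : (0 <= mean_count K i l)%E.
Proof. by apply: esum_ge0 => s _; exact: nat_wt_ge0. Qed.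

Lemma mean_visits_ge0 K i : (0 <= mean_visits K i)%E.
Proof. by apply: esum_ge0 => s _; exact: nat_wt_ge0. Qed.

Lemma mean_count0 K i : i <= 0 -> excisable i K ->
  mean_count K i 0 = ((alpha i)%:E * mean_visits K i)%E.
Proof.
move=> i0 [Kc HK]; have i1 : i - 1 <= 0 by lia.
rewrite /mean_count /mean_visits.
rewrite (@esum_excise _ w K i (i - 1))//; [|lia|]; last first.
  by move=> t l v wt wl; apply: HK => //; rewrite (_ : i - (i - 1) = 1)//; lia.
rewrite (massE hPw jp2_gt0)// -!EFinM (alphaE hPw jp1_gt0 jp2_gt0)//;
  congr (_%:E * _)%E.
by rewrite -trans_up1 subrK.
Qed.

Lemma mean_count1 K i : i <= 0 -> excisable i K ->
  mean_count K i 1 = ((beta i)%:E * mean_visits K i)%E.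
Proof.
move=> i0 [Kc HK]; have i1 : i - 1 <= 0 by lia.
rewrite /mean_count /mean_visits.
rewrite (@esum_excise _ w K i (i - 2))//; [|lia|]; last first.
  by move=> t l v wt wl; apply: HK => //; rewrite (_ : i - (i - 2) = 2)//; lia.
have E : i - 2 = i - 1 - 1 by lia.
(* A loop closed from [i - 2] descends one level further, which brings the extra factor
   [jq (w (i - 1)) * green (i - 2)]. *)
rewrite {1}E (mass_down1 hPw jp2_gt0)// (massE hPw jp2_gt0)// -!EFinM.
rewrite (betaE hPw jp1_gt0 jp2_gt0)// (gammaE hPw jp2_gt0)//; congr (_%:E * _)%E.
have -> : trans w (i - 2) i = jp2 (w (i - 1 - 1)) by rewrite -trans_up2 E;
  congr trans; lia.
ring.
Qed.

Lemma mass_lty (n : nat) : (mass 0 0 (- n%:Z) < +oo)%E.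
Proof.
elim: n => [|n IH]; first by rewrite (massE hPw jp2_gt0)// ltry.
have -> : - n.+1%:Z = - n%:Z - 1 by lia.
rewrite (mass_down1 hPw jp2_gt0); [|lia|lia].
have : (0 <= mass 0 0 (- n%:Z))%E by exact: mass_ge0.
by case: (mass 0 0 (- n%:Z)) IH => // r _ _; rewrite -EFinM ltry.
Qed.

Lemma mean_visitsE K i : i <= 0 -> K `<=` [set s | exit_word 0 0 s] ->
  mean_visits K i = (\esum_(u in [set u | word 0 0 i u])
    ((wt 0 u)%:E * \esum_(v in [set v | K (u ++ v)]) (wt i v)%:E))%E.
Proof.
move=> i0 Kc; rewrite /mean_visits (esum_visits _ Kc i0); last exact: wtE_ge0.
apply: eq_esum => u /= wu; rewrite -esumZl; [|exact: wtE_ge0|exact: wtE_ge0].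
by apply: eq_esum => v _; rewrite wt_cat (word_pos wu) EFinM.
Qed.

(** Continuations after a marked visit have total weight at most 1, so the Green function bounds the
    mean number of visits. Finiteness is what lets [sum_mean_count] solve for it. *)
Lemma mean_visits_lty K i : i <= 0 -> K `<=` [set s | exit_word 0 0 s] ->
  (mean_visits K i < +oo)%E.
Proof.
move=> i0 Kc; rewrite mean_visitsE//.
apply: (@le_lt_trans _ _ (mass 0 0 i)); last first.
  by have := mass_lty `|i|; rewrite (_ : - `|i|%:Z = i)//; lia.
apply: le_esum => u /= wu; rewrite -[leRHS]mule1; apply: lee_pmul => //;
  first exact: wtE_ge0.
  by apply: esum_ge0 => v _; exact: wtE_ge0.
apply: le_trans (esum_exit_le1 hPw 0 i).
rewrite [leLHS]esum_mkcond [leRHS]esum_mkcond; apply: le_esum => v _.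
case: ifPn => [|_]; last by case: ifP => _; rewrite ?wtE_ge0.
rewrite inE => /= /Kc /=; rewrite exit_word_cat (word_pos wu)// => /andP[_ ev].
by rewrite mem_set.
Qed.

Lemma mean_visits_count K i : i <= 0 -> K `<=` [set s | exit_word 0 0 s] ->
  mean_visits K i = (mean_count K i 0 + mean_count K i 1 +
                     \sum_(l < 3) mean_count K (i + 1) l)%E.
Proof.
move=> i0 Kc; rewrite /mean_count -esum_sum; last by move=> *; exact: nat_wt_ge0.
rewrite -!esumD; do ?by move=> *; exact: nat_wt_ge0.
apply: eq_esum => s /Kc es; rewrite (visits_Ucount i0 es) !natrD natr_sum !EFinD.
rewrite !ge0_muleDl ?lee_fin ?sumr_ge0 ?addr_ge0//; congr (_ + _)%E.
by rewrite -sumEFin ge0_sume_distrl// => l _; rewrite lee_fin.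
- by move=> s _; rewrite adde_ge0// nat_wt_ge0.
- by move=> s _; rewrite sume_ge0// => l _; exact: nat_wt_ge0.
Qed.

Lemma NmxE i (k l : 'I_3) : Nmx Pw w i k l =
  tnth [tuple alpha i / (1 - alpha i - beta i); beta i / (1 - alpha i - beta i);
              (k == 1)%:R] l.
Proof.
rewrite /Nmx mxE; case: k => -[|[|[|//]]] kp; rewrite (tnth_nth 0) /= row3E;
by case: l => -[|[|[|//]]] lp; rewrite !(tnth_nth 0).
Qed.

Lemma mean_count2 K i : mean_count K i ord_max = mean_count K (i + 1) 1.
Proof. by apply: eq_esum => s _; rewrite Ucount2. Qed.

Lemma mean_count_fin K i l : i <= 0 -> K `<=` [set s | exit_word 0 0 s] ->
  mean_count K (i + 1) l \is a fin_num.
Proof.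
move=> i0 Kc; rewrite ge0_fin_numE ?mean_count_ge0//.
apply: le_lt_trans (mean_visits_lty i0 Kc); rewrite mean_visits_count//.
apply: (@le_trans _ _ (\sum_(l < 3) mean_count K (i + 1) l)%E).
  rewrite (bigD1 l)//= leeDl// sume_ge0// => *; exact: mean_count_ge0.
by rewrite leeDr// adde_ge0// mean_count_ge0.
Qed.

Lemma sum_mean_count K i : i <= 0 -> excisable i K ->
  (\sum_(k < 3) mean_count K (i + 1) k =
   (1 - alpha i - beta i)%:E * mean_visits K i)%E.
Proof.
move=> i0 HK; have Kc := HK.1; have := mean_visits_count i0 Kc.
rewrite mean_count0// mean_count1//.
have vf : mean_visits K i \is a fin_num.
  by rewrite ge0_fin_numE ?mean_visits_ge0 ?mean_visits_lty.
have sf : (\sum_(l < 3) mean_count K (i + 1) l)%E \is a fin_num.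
  by apply/sum_fin_numP => l _ _; exact: mean_count_fin.
rewrite -(fineK vf) -(fineK sf) -!EFinM -!EFinD => -[e]; congr _%:E; lra.
Qed.

(** The first two columns of [Nmx] are constant, so only the mean total of [U(i + 1)] enters, which
    [sum_mean_count] turns into visits. The third column picks out type B of [U(i + 1)], because
    [C(i) = B(i + 1)]. *)
Lemma mean_count_Nmx K i l : i <= 0 -> excisable i K ->
  mean_count K i l = (\sum_(k < 3) mean_count K (i + 1) k * (Nmx Pw w i k l)%:E)%E.
Proof.
move=> i0 HK; have Kc := HK.1; have D0 := alpha_beta_lt1 hPw jp1_gt0 jp2_gt0 i0.
have vf : mean_visits K i \is a fin_num.
  by rewrite ge0_fin_numE ?mean_visits_ge0 ?mean_visits_lty.
have scale (c : R) : 0 <= c -> (\sum_(k < 3) mean_count K (i + 1) k * (c / (1 -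
  alpha i - beta i))%:E =
   c%:E * mean_visits K i)%E.
  move=> c0; rewrite -ge0_sume_distrl; last by move=> k _; exact: mean_count_ge0.
  rewrite sum_mean_count// -(fineK vf) -!EFinM; congr _%:E; field.
  exact: lt0r_neq0.
have [-> | -> | ->] : [\/ l = 0, l = 1 | l = ord_max].
  by case: l => -[|[|[|//]]] lp; [constructor 1|constructor 2|constructor 3];
    exact: val_inj.
- rewrite mean_count0// -scale ?(alpha_ge0 hPw jp1_gt0 jp2_gt0)//.
  by apply: eq_bigr => k _; rewrite NmxE.
- rewrite mean_count1// -scale ?(beta_ge0 hPw jp1_gt0 jp2_gt0)//.
  by apply: eq_bigr => k _; rewrite NmxE.
rewrite mean_count2 (bigD1 1)//= big1 ?adde0.
  by rewrite NmxE (tnth_nth 0) /= mule1.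
by move=> k /negPf k1; rewrite NmxE (tnth_nth 0) /= k1 mule0.
Qed.

End quenched.

(** * Offspring means and expected hitting time *)

Lemma exit_word_down k n s : k <= 0 ->
  exit_word 0 k (nseq n (-1) ++ s) = exit_word 0 (k - n%:Z) s.
Proof.
elim: n k => [|n IH] k k0 /=; first by rewrite subr0.
by rewrite k0 IH /=; [congr exit_word|]; lia.
Qed.

Lemma exit_word_up k n : k <= 1 -> k + n%:Z = 1 -> exit_word 0 k (nseq n 1).
Proof.
elim: n k => [|n IH] k k1 kn /=; first lia.
by apply/andP; split; [lia|apply: IH; lia].
Qed.

Lemma pos_down k n : pos k (nseq n (-1)) = k - n%:Z.
Proof. by elim: n k => [|n IH] k /=; [rewrite subr0|rewrite IH; lia]. Qed.

Lemma jumps_down a b k n : a < b -> jumps a b k (nseq n (-1)) = 0%N.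
Proof. by move=> ab; elim: n k => [//|n IH] k /=; rewrite IH; case: eqP => //=;
  lia. Qed.

Lemma jumps_up a b k n : a < k -> jumps a b k (nseq n 1) = 0%N.
Proof.
elim: n k => [//|n IH] k ak /=; rewrite IH; last lia.
by case: eqP => //=; lia.
Qed.

(** Guarantees that the conditioning events of the offspring means are not null. The witness
    descends, makes one jump out of [(-oo, i]], then climbs by unit steps to 1. *)
Lemma exists_single_crossing (i : int) (l : 'I_3) : i <= 0 ->
  exists s, exit_word 0 0 s /\
    forall l', tnth (Ucount (i + 1) s) l' = (l == l') :> nat.
Proof.
move=> i0; pose n := `|i|%N.
have words m z j : step z -> - m%:Z <= i -> i < - m%:Z + z ->
    - m%:Z + z <= 1 -> - m%:Z + z + j%:Z = 1 ->
    exists s, exit_word 0 0 s /\ forall a b, a <= i -> i < b ->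
      jumps a b 0 s = ((- m%:Z == a) && (- m%:Z + z == b)).
  move=> sz mi imz mz1 mzj; exists (nseq m (-1) ++ z :: nseq j 1); split.
    by rewrite exit_word_down//= sub0r sz exit_word_up// andbT; lia.
  move=> a b ai ib; rewrite jumps_cat jumps_down ?pos_down; last lia.
  by rewrite /= sub0r jumps_up ?addn0; lia.
case: l => -[|[|[|//]]] lp.
- have [|||||s [es js]] := words n 1 n => //; rewrite /n; try lia.
  by exists s; split => // -[[|[|[|//]]] lp']; rewrite (tnth_nth 0%N) /= js; lia.
- have [|||||s [es js]] := words n.+1 2 n => //; rewrite /n; try lia.
  by exists s; split => // -[[|[|[|//]]] lp']; rewrite (tnth_nth 0%N) /= js; lia.
(* From [i = 0] the jump by 2 exits at 2, past the end point 1 of the other witnesses. *)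
- have [n0|n0] := posnP n.
    have -> : i = 0 by lia.
    by exists [:: 2]; split => // -[[|[|[|//]]] lp'].
  have [|||||s [es js]] := words n 2 n.-1 => //; rewrite /n; try lia.
  by exists s; split => // -[[|[|[|//]]] lp']; rewrite (tnth_nth 0%N) /= js; lia.
Qed.

Section quenched.
Context {R : realType} (Pw : env R -> int -> probability paths R) (w : env R).
Hypothesis hPw : forall k, is_walk_law w k (Pw w k).
Hypothesis jq_gt0 : forall k : int, k <= 0 -> 0 < jq (w k).
Hypothesis jp1_gt0 : forall k : int, k <= 0 -> 0 < jp1 (w k).
Hypothesis jp2_gt0 : forall k : int, k <= 0 -> 0 < jp2 (w k).
Hypothesis exits_ae : {ae Pw w 0, forall x, exists N, exits 0 x N}.

Local Notation wt := (wt w).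
Local Notation mass := (mass w).
Local Notation green := (green w).
Local Notation alpha := (alpha Pw w).
Local Notation beta := (beta Pw w).
Local Notation gamma := (gamma Pw w).
Local Notation mean_count := (mean_count w).
Local Notation mean_visits := (mean_visits w).

Lemma exit_word_wt_gt0 k s : exit_word 0 k s -> 0 < wt k s.
Proof.
elim: s k => [//|z s IH] k /= /and3P[k0 /stepP sz /IH h]; apply: mulr_gt0 => //.
by case: sz => ->; rewrite ?trans_down ?trans_up1 ?trans_up2 ?jq_gt0 ?jp1_gt0 ?jp2_gt0.
Qed.

(** Almost sure exit makes the values of [f] on paths that never exit irrelevant. *)
Lemma integral_exit0 (f : paths -> \bar R) (h : seq int -> nat) :
  measurable_fun [set: paths] f -> (forall x, 0 <= f x)%E ->
  (forall x N, proper_path 0 x -> exits 0 x N -> f x = (h (path_word x N))%:R%:E) ->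
  (\int[Pw w 0]_x f x =
   \esum_(s in [set s | exit_word 0 0 s]) ((h s)%:R%:E * (wt 0 s)%:E))%E.
Proof.
move=> mf f0 fh; apply: (integral_exit (hPw 0) (F := fun s => (h s)%:R)) => //.
have FF := ae_filter_ringOfSetsType (Pw w 0).
by apply: (filterS _ exits_ae) => x [N xN] /(_ N).
Qed.

Lemma esum_exit1 : (\esum_(s in [set s | exit_word 0 0 s]) (wt 0 s)%:E = 1)%E.
Proof.
rewrite -(_ : \int[Pw w 0]_x (cst 1 x) = 1)%E; last first.
  by rewrite integral_cst// mul1e; exact: probability_setT.
rewrite (integral_exit0 (h := fun=> 1%N))//.
by apply: eq_esum => s _; rewrite mul1e.
Qed.

Lemma measurable_U_eq i u : measurable [set x : paths | U R x i = u].
Proof.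
rewrite (_ : [set _ | _] = \bigcap_(l in [set: 'I_3])
    [set x | U R x i ord0 l = u ord0 l]).
  apply: fin_bigcap_measurable => // l _; rewrite -[X in measurable X]setTI.
  exact: (measurable_U i l measurableT (emeasurable_set1 _)).
apply/seteqP; split=> x /=; first by move=> <- l _.
by move=> H; apply/rowP => l; apply: H.
Qed.

Definition single_crossing (i : int) (k : 'I_3) : set (seq int) :=
  [set s | exit_word 0 0 s /\ forall l, tnth (Ucount (i + 1) s) l = (k == l) :> nat].

Lemma integral_single_crossing i (k : 'I_3) (f : paths -> \bar R) (h : seq int -> nat) :
  i <= 0 -> measurable_fun [set: paths] f -> (forall x, 0 <= f x)%E ->
  (forall x N, proper_path 0 x -> exits 0 x N -> f x = (h (path_word x N))%:R%:E) ->
  (\int[Pw w 0]_(x in [set x | U R x (i + 1)%R = unit_vec R k]) f x =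
   \esum_(s in single_crossing i k) ((h s)%:R%:E * (wt 0 s)%:E))%E.
Proof.
move=> i0 mf f0 fh; set E := [set x | _].
have mE : measurable E by exact: measurable_U_eq.
pose B := [set s | forall l, tnth (Ucount (i + 1) s) l = (k == l) :> nat].
rewrite integral_mkcond.
rewrite (integral_exit0 (f := f \_ E) (h := fun s => if s \in B then h s else 0%N)).
- rewrite (_ : single_crossing i k = [set s | exit_word 0 0 s] `&` B)//.
  rewrite esum_mkcondr; apply: eq_esum => s _.
  by case: ifP => // _; rewrite mul0e.
- by apply: (measurable_restrictT f mE).1; exact: measurable_funTS.
- by move=> x; rewrite patchE; case: ifP.
- move=> x N px xN; rewrite patchE (fh _ _ px xN).
  have EB : E x <-> B (path_word x N).
    rewrite /E /B /=; split=> [e l|H].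
      move/rowP: e => /(_ l); rewrite (U_exit _ px xN); last lia.
      by rewrite mxE => -[] /eqP; rewrite eqr_nat => /eqP.
    by apply/rowP => l; rewrite (U_exit _ px xN) ?H ?mxE//; lia.
  case: (boolP (path_word x N \in B)) => [/set_mem/EB xE|/negP xB];
    first by rewrite mem_set.
  by rewrite memNset// => /EB xE; apply: xB; rewrite inE.
Qed.

(** When [U(i + 1)] is the [k]-th unit vector, the recursion [mean_count_Nmx] reduces to its [k]-th
    term, the probability [p] of the event times an entry of [Nmx]; dividing by [p > 0] leaves the
    entry. *)
Lemma offspring_meanE i : i <= 0 ->
  offspring_mean (Pw w 0) i = map_mx EFin (Nmx Pw w i).
Proof.
move=> i0; apply/matrixP => k l; rewrite mxE [RHS]mxE.
set E := [set x | _]; set K := single_crossing i k.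
pose p := (\esum_(s in K) (wt 0 s)%:E)%E.
have HK : excisable i K by exact: excisable_Ucount.
have PE : Pw w 0 E = p.
  rewrite -[LHS]mul1e -integral_cst; last exact: measurable_U_eq.
  rewrite (integral_single_crossing k i0 (h := fun=> 1%N))//.
  by apply: eq_esum => s _; rewrite mul1e.
have p1 : (p <= 1)%E.
  rewrite -esum_exit1 /p [leLHS]esum_mkcond [leRHS]esum_mkcond; apply: le_esum => s _.
  case: ifPn => [|_]; last by case: ifP => _; rewrite ?wtE_ge0.
  by rewrite inE => -[es _]; rewrite mem_set.
have p0 : (0 < p)%E.
  have [s [es Hs]] := exists_single_crossing k i0.
  apply: (@lt_le_trans _ _ (wt 0 s)%:E); first by rewrite lte_fin exit_word_wt_gt0.
  apply: esum_ge; exists [set s]; last by rewrite fsbig_set1.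
  by split; [exact: finite_set1|move=> _ ->].
rewrite (integral_single_crossing k i0 (h := fun s => tnth (Ucount i s) l));
  last 3 first.
- exact: measurable_U.
- by move=> x; exact: U_ge0.
- by move=> x N px xN; rewrite (U_exit _ px xN)//; lia.
rewrite -/(mean_count K i l) (mean_count_Nmx hPw jp1_gt0 jp2_gt0 l i0 HK).
have mc k' : mean_count K (i + 1) k' = ((k == k')%:R%:E * p)%E.
  rewrite /p -esumZl ?lee_fin//; last by move=> s; exact: wtE_ge0.
  by apply: eq_esum => s -[_ ->].
rewrite (bigD1 k)//= big1 => [|k' k'k]; last first.
  by rewrite mc eq_sym (negPf k'k) !mul0e.
rewrite adde0 mc eqxx mul1e [X in (_ / X)%E](_ : _ = p)//.
have pf : p \is a fin_num by rewrite ge0_fin_numE ?(ltW p0)// (le_lt_trans p1) ?ltry.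
have fp0 : fine p != 0 by rewrite gt_eqF// fine_gt0// p0 (le_lt_trans p1) ?ltry.
rewrite -(fineK pf) inver (negPf fp0) -!EFinM; congr EFin.
by rewrite mulrAC mulfV ?mul1r.
Qed.

Local Notation total := [set s | exit_word 0 0 s].

(** After any visit to 0 the walk exits almost surely, so the continuations have total weight 1. *)
Lemma mean_visits00 : mean_visits total 0 = (green 0)%:E.
Proof.
rewrite mean_visitsE// -(massE hPw jp2_gt0)//; apply: eq_esum => u /= wu.
rewrite (_ : [set v | _] = total) ?esum_exit1 ?mule1//.
by apply/seteqP; split=> v /=; rewrite exit_word_cat (word_pos wu)//= wu.
Qed.

(** An exit word crosses from [(-oo, 0]] to the positive sites exactly once. *)
Lemma sum_immigrant : (\sum_(l < 3) mean_count total 1 l = 1)%E.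
Proof.
rewrite /mean_count -esum_sum; last by move=> *; exact: nat_wt_ge0.
rewrite -esum_exit1; apply: eq_esum => s /= es.
rewrite -ge0_sume_distrl; last by move=> l _; rewrite lee_fin.
rewrite sumEFin -natr_sum (_ : bigop.body _ _ _ = 1%N) ?mul1e//.
have := upcross_exit_word (lexx 0) es.
rewrite (@jumps_exit_word0 (0 + 1) 0 0 0 s es)// ltxx addn0 => e.
by apply: etrans e; rewrite !big_ord_recl big_ord0 !(tnth_nth 0%N) addn0 addnA.
Qed.

(** The immigrant types are the possible final jumps, from 0 or from -1, so their means are Green
    functions times jump probabilities. *)
Lemma mean_count_immigrant l :
  mean_count total 1 l = (immigrant_mean Pw w ord0 l)%:E.
Proof.
have J a b : a <= 0 -> 0 < b -> step (b - a) ->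
   (\esum_(s in total) ((jumps a b 0 s)%:R%:E * (wt 0 s)%:E) =
    mass 0 0 a * (trans w a b)%:E)%E by exact: esum_exit_jump.
have D0 := alpha_beta_lt1 hPw jp1_gt0 jp2_gt0 (lexx 0).
have g0 : mass 0 0 0 = (green 0)%:E by rewrite (massE hPw jp2_gt0).
(* [sum_mean_count] at level 0, where the single immigrant gives
   [1 = (1 - alpha 0 - beta 0) * green 0]: the prefactor is the mean number of visits to 0. *)
have gD : green 0 = (1 - alpha 0 - beta 0)^-1.
  have := sum_mean_count hPw jp1_gt0 jp2_gt0 (lexx 0) (excisable_exit_word 0).
  rewrite mean_visits00 add0r sum_immigrant => -[e].
  by rewrite -[RHS]mulr1 [X in _ * X]e mulKf// gt_eqF.
rewrite /immigrant_mean mxE -gD row3E.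
case: l => -[|[|[|//]]] lp; rewrite (tnth_nth 0) /mean_count /=.
- by rewrite -(trans_up1 w 0) EFinM -g0 -J//; apply: eq_esum => s _.
- transitivity (mass 0 0 (-1) * (trans w (-1) 1)%:E)%E.
    by rewrite -J//; apply: eq_esum => s _.
  have -> : mass 0 0 (-1) = mass 0 0 (0 - 1) by [].
  rewrite (mass_down1 hPw jp2_gt0)// g0 -!EFinM (gammaE hPw jp2_gt0)//.
  have -> : trans w (-1) 1 = jp2 (w (0 - 1)) by rewrite -trans_up2.
  by congr EFin; ring.
- by rewrite -(trans_up2 w 0) EFinM -g0 -J//; apply: eq_esum => s _.
Qed.

Lemma mean_count_prod n l : mean_count total (- n%:Z) l =
  ((immigrant_mean Pw w *m \prod_(j < n.+1) Nmx Pw w (- j%:Z)) ord0 l)%:E.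
Proof.
have step_down (i : int) (u : 'rV[R]_3) : i <= 0 -> (forall k, mean_count total
  (i + 1) k = (u ord0 k)%:E) ->
  forall l, mean_count total i l = ((u *m Nmx Pw w i) ord0 l)%:E.
  move=> i0 hu l'.
  rewrite (mean_count_Nmx hPw jp1_gt0 jp2_gt0 l' i0 (excisable_exit_word i)).
  by rewrite mxE -sumEFin; apply: eq_bigr => k _; rewrite hu EFinM.
elim: n l => [|n IH] l.
  rewrite big_ord_recl big_ord0 mulr1; apply: step_down => // k.
  exact: mean_count_immigrant.
rewrite big_ord_recr /= -mulmxE mulmxA; apply: step_down; first lia.
by have -> : - n.+1%:Z + 1 = - n%:Z by lia.
Qed.

(** Each unit of time before [T1] is a departure from a site at most 0, so [T1] is the sum of the
    visits to these sites; nonnegativity permits exchanging the sums. *)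
Lemma integral_T1 :
  (\int[Pw w 0]_x T1 R x = \sum_(n <oo) mean_visits total (- n%:Z)%R)%E.
Proof.
rewrite (integral_exit0 (h := size)); last 3 first.
- exact: measurable_T1.
- by move=> x; exact: T1_ge0.
- by move=> x N [x0 _] xN; rewrite (T1_exit x0 xN) size_path_word.
rewrite nneseries_esumT; last by move=> n; exact: mean_visits_ge0.
rewrite /mean_visits esum_esum; last by move=> *; exact: nat_wt_ge0.
transitivity (\esum_(s in total) \esum_(n in [set: nat])
    ((visits (- n%:Z)%R 0 s)%:R%:E * (wt 0 s)%:E))%E; last first.
  rewrite esum_esum; last by move=> *; exact: nat_wt_ge0.
  rewrite [LHS](reindex_esum ([set: nat] `*`` (fun=> total)) _ (fun p => (p.2, p.1)))//.
  split; first by move=> [n s] [].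
    by move=> [n s] [n' s'] _ _ [-> ->].
  by move=> [s n] [es _]; exists (n, s).
apply: eq_esum => s /= es; pose N := (size s).*2.
have v0 n : (N <= n)%N -> visits (- n%:Z) 0 s = 0%N.
  (* The partial sums up to [n] and up to [n.+1] both equal the length of [s], so the term at [n]
     vanishes. *)
  move=> Nn; have := sum_visits_exit_word es (leqnn N : (absz 0 + N <= N)%N).
  have := @sum_visits_exit_word 0 s n.+1 es (leqW Nn).
  have := @sum_visits_exit_word 0 s n es Nn.
  by rewrite big_ord_recr /=; lia.
transitivity (\esum_(n in [set n | (n < N)%N && true])
    ((visits (- n%:Z)%R 0 s)%:R%:E * (wt 0 s)%:E))%E; last first.
  rewrite [LHS]esum_mkcond; apply: eq_esum => n _; case: ifPn => //.
  move=> /negP nN; rewrite v0 ?mul0e// leqNgt; apply/negP => nN'; apply: nN.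
  by rewrite inE /= nN'.
rewrite (esum_ord N xpredT); last by move=> n; exact: nat_wt_ge0.
rewrite -ge0_sume_distrl; last by move=> n _; rewrite lee_fin.
by rewrite sumEFin -natr_sum (@sum_visits_exit_word 0 s N es).
Qed.

Lemma immigrant_mean_ge0 l : 0 <= immigrant_mean Pw w ord0 l.
Proof. by rewrite -lee_fin -mean_count_immigrant mean_count_ge0. Qed.

Lemma Nmx_ge0 i k l : i <= 0 -> 0 <= Nmx Pw w i k l.
Proof.
move=> i0; have D0 := ltW (alpha_beta_lt1 hPw jp1_gt0 jp2_gt0 i0).
have a0 := alpha_ge0 hPw jp1_gt0 jp2_gt0 i0; have b0 := beta_ge0 hPw jp1_gt0 jp2_gt0 i0.
rewrite NmxE; case: l => -[|[|[|//]]] lp; rewrite (tnth_nth 0) /=.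
- exact: divr_ge0.
- exact: divr_ge0.
- exact: ler0n.
Qed.

Lemma prod_Nmx_ge0 n k l : 0 <= (\prod_(j < n) Nmx Pw w (- j%:Z)) k l.
Proof.
elim: n k l => [|n IH] k l; first by rewrite big_ord0 mxE ler0n.
rewrite big_ord_recr /= -mulmxE mxE sumr_ge0// => j _.
by rewrite mulr_ge0// Nmx_ge0//; lia.
Qed.

Lemma series_mean_count l :
  (\sum_(n <oo) mean_count total (- n%:Z)%R l =
   erow_mul (immigrant_mean Pw w) (Nsum Pw w) ord0 l)%E.
Proof.
rewrite mxE (eq_eseriesr (g := fun n => \sum_(k < 3) (immigrant_mean Pw w ord0 k)%:E *
    ((\prod_(j < n.+1) Nmx Pw w (- j%:Z)%R) k l)%:E)%E); last first.
  by move=> n _; rewrite mean_count_prod mxE -sumEFin.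
rewrite nneseries_sum; last first.
  by move=> k n _; rewrite lee_fin mulr_ge0 ?immigrant_mean_ge0 ?prod_Nmx_ge0.
apply: eq_bigr => k _; rewrite nneseriesZl.
  by congr (_ * _)%E; rewrite [RHS]mxE.
by move=> n _; rewrite lee_fin prod_Nmx_ge0.
Qed.

(** When [V(i) = A(i) + B(i) + |U(i + 1)|] is summed over [i <= 0], the last terms give 1 for the
    immigrant plus the sum of all [|U(i)|]. Hence types A and B count twice and type C once. *)
Lemma integral_T1E : (\int[Pw w 0]_x T1 R x =
  1 + einner (row3 2 2 1)%R (erow_mul (immigrant_mean Pw w) (Nsum Pw w)))%E.
Proof.
pose u n l := mean_count total (- n%:Z) l.
have u0 n l : (0 <= u n l)%E by exact: mean_count_ge0.
pose s n := (\sum_(l < 3) mean_count total (- n%:Z + 1)%R l)%E.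
have s0 n : (0 <= s n)%E by apply: sume_ge0 => l _; exact: mean_count_ge0.
rewrite integral_T1 (eq_eseriesr (g := fun n => u n 0%R + u n 1%R + s n)%E); last first.
  by move=> n _; rewrite mean_visits_count//; lia.
rewrite nneseriesD; [|by move=> *; rewrite adde_ge0|by []].
rewrite nneseriesD; [|by []|by []].
have -> : (\sum_(n <oo) s n = 1 + \sum_(l < 3) \sum_(n <oo) u n l)%E.
  rewrite nneseries_recl// -nneseries_addn//; congr (_ + _)%E.
    by rewrite -sum_immigrant.
  rewrite -nneseries_sum//; apply: eq_eseriesr => n _; apply: eq_bigr => l _.
  by rewrite /u; have -> : - (n + 1)%N%:Z + 1 = - n%:Z by lia.
rewrite /einner.
under [in RHS]eq_bigr do rewrite -series_mean_count.
pose S l := (\sum_(n <oo) u n l)%E.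
have S0 l : (0 <= S l)%E by exact: nneseries_ge0.
rewrite -/(S 0) -/(S 1).
rewrite !big_ord_recl !big_ord0 !row3E !(tnth_nth 0) /= !adde0 mul1e -!/(S _).
have -> : lift ord0 (ord0 : 'I_2) = 1 :> 'I_3 by exact: val_inj.
have := S0 ord0; have := S0 1; have := S0 (lift ord0 (lift ord0 ord0)).
(* If one of the series is infinite, both sides are [+oo]; only finite values remain for the ring
   computation. *)
case: (S ord0) => [a| |] //; case: (S 1) => [b| |] //;
  case: (S (lift _ _)) => [c| |] // _ _ _; rewrite ?gt0_muley ?lte_fin//.
by rewrite -!EFinM -!EFinD; congr EFin; ring.
Qed.

End quenched.

(** * Almost every environment *)

Section ae_facts.
Context {R : realType}.

Import HBNNSimple.

(* [f] is not assumed measurable: its integral is a supremum of integrals of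
   simple minorants, whose countable supremum is a measurable minorant. *)
Lemma ae_eq1_of_integral d (T : measurableType d) (P : probability T R)
    (f : T -> \bar R) : (forall x, 0 <= f x <= 1)%E ->
  (\int[P]_x f x = 1)%E -> {ae P, forall x, f x = 1%E}.
Proof.
move=> f01; rewrite ge0_integralTE; last by move=> x; case/andP: (f01 x).
set S := [set _ | _ in _] => supS.
have /choice[h Hh] n : exists h : {nnsfun T >-> R}, (forall x, ((h x)%:E <= f x)%E) /\
    ((1 - n.+1%:R^-1)%:E < sintegral P h)%E.
  have : ((1 - n.+1%:R^-1)%:E < ereal_sup S)%E.
    by rewrite supS lte_fin ltrBlDr ltrDl invr_gt0.
  by move=> /ereal_sup_gt[_ [h hf <-] lth]; exists h.
pose g x := ereal_sup (range (fun n => (h n x)%:E)).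
have gE : g = (fun x => esups (fun n => (h n x)%:E) 0%N).
  apply/funext => x; rewrite /g /esups /=; congr ereal_sup.
  by apply/seteqP; split=> _ [n _ <-]; exists n.
have mg : measurable_fun [set: T] g.
  rewrite gE; apply: (measurable_fun_esups (f := fun n x => (h n x)%:E)) => n.
  by apply/measurable_EFinP; exact: measurable_funPT.
have hg n x : ((h n x)%:E <= g x)%E by apply: ereal_sup_ubound; exists n.
have g0 x : (0 <= g x)%E by apply: le_trans (hg 0%N x); rewrite lee_fin.
have gf x : (g x <= f x)%E by apply: ge_ereal_sup => _ [n _ <-]; exact: (Hh n).1.
have g1 x : (g x <= 1)%E by apply: le_trans (gf x) _; case/andP: (f01 x).
have mg' : measurable_fun [set: T] (fun x => 1 - g x)%E.
  by apply: emeasurable_funB => //; exact: measurable_cst.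
have g0' x : (0 <= 1 - g x)%E by rewrite sube_ge0 ?g1// orbT.
have gfin x : g x \is a fin_num by rewrite ge0_fin_numE// (le_lt_trans (g1 x)) ?ltry.
have I1 : (1 = \int[P]_x g x + \int[P]_x (1 - g x))%E.
  rewrite -ge0_integralD//; transitivity (\int[P]_x (cst 1 x))%E.
    by rewrite integral_cst// mul1e; apply/esym; exact: probability_setT.
  by apply: eq_integral => x _; rewrite addeC subeK.
have Ig : (1 <= \int[P]_x g x)%E.
  apply/lee_addgt0Pr => e e0; pose n := Num.truncn e^-1.
  have ne : n.+1%:R^-1 <= e.
    by rewrite invf_ple ?posrE// ltW// truncnS_gt.
  apply: (@le_trans _ _ ((1 - n.+1%:R^-1)%:E + e%:E)%E).
    by rewrite -EFinD lee_fin; rewrite -addrA lerDl addrC subr_ge0.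
  apply: leeD => //; apply: le_trans (ltW (Hh n).2) _.
  rewrite -integralT_nnsfun; apply: ge0_le_integral => //.
  - by move=> x _; rewrite lee_fin.
  - by apply/measurable_EFinP; exact: measurable_funPT.
have I0 : (\int[P]_x (1 - g x) = 0)%E.
  have : (0 <= \int[P]_x (1 - g x))%E by exact: integral_ge0.
  move: I1 Ig; case: (\int[P]_x g x)%E => [a| |] //;
    case: (\int[P]_x (1 - g x))%E => [b| |] //.
  by rewrite -EFinD => -[ab]; rewrite !lee_fin => a1 b0; congr EFin; lra.
(* [1 - g] is nonnegative with integral 0, so [g = 1] almost everywhere, and [f] lies between [g]
   and 1. *)
have := (ae_eq_integral_abs P measurableT mg').1.
under eq_integral do rewrite gee0_abs//.
move=> /(_ I0); have FF := ae_filter_ringOfSetsType P.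
apply: filterS => x /(_ I) /= gx; apply/eqP; rewrite eq_le (andP (f01 x)).2 /=.
apply: le_trans (gf x); rewrite -(subeK 1%E (gfin x)) gx add0e.
exact: lexx.
Qed.

(** Integer levels express the limit by countable operations, as measurability requires. *)
Lemma walk_to_pinftyP (x : paths) : walk_to_pinfty R x <->
  forall A : nat, exists M, forall n, (M <= n)%N -> A%:Z <= x n.
Proof.
split.
  move=> /cvgryPge H A; have [M _ HM] := H A%:R.
  exists M => n Mn; have := HM n Mn => /=.
  by rewrite -(ler_int R) pmulrn.
move=> H; apply/cvgryPge => A; have [M HM] := H (Num.bound `|A|).
exists M => // n /= Mn; apply: (@le_trans _ _ (Num.bound `|A|)%:R).
  by apply: le_trans (ler_norm A) _; apply: ltW; exact: archi_boundP.
by have := HM n Mn; rewrite -(ler_int R) pmulrn.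
Qed.

Lemma measurable_walk_to_pinfty : measurable [set x : paths | walk_to_pinfty R x].
Proof.
rewrite (_ : [set _ | _] = \bigcap_(A : nat) \bigcup_(M : nat)
    \bigcap_(n : nat) [set x : paths | (M <= n)%N -> A%:Z <= x n]).
  apply: bigcapT_measurable => A; apply: bigcupT_measurable => M.
  apply: bigcapT_measurable => n.
  by apply: (@measurable_horizon n.+1) => x y xy /=; rewrite xy.
apply/seteqP; split=> x /=.
  by move=> /walk_to_pinftyP H A _; have [M HM] := H A; exists M => // n _; exact: HM.
move=> H; apply/walk_to_pinftyP => A; have [M _ HM] := H A I.
by exists M => n; exact: HM.
Qed.

Lemma exits_of_pinfty (x : paths) : walk_to_pinfty R x -> exists N, exits 0 x N.
Proof.
move=> /walk_to_pinftyP /(_ 1%N)[M HM].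
have ex : exists n, 0 < x n by exists M; have := HM M (leqnn M); lia.
case: (ex_minnP ex) => N xN Nmin; exists N; split=> // m mN.
by rewrite leNgt; apply/negP => /Nmin; lia.
Qed.

Lemma exits_ae_of_pinfty (Q : probability paths R) :
  Q [set x | walk_to_pinfty R x] = 1%E -> {ae Q, forall x, exists N, exits 0 x N}.
Proof.
move=> Q1; exists (~` [set x : paths | walk_to_pinfty R x]); split.
- by apply: measurableC; exact: measurable_walk_to_pinfty.
- apply: etrans (probability_setC Q measurable_walk_to_pinfty) _.
  by rewrite Q1 subee.
- by apply: subsetC => x; exact: exits_of_pinfty.
Qed.

Lemma pinfty_ae (P : probability (env R) R) (Pw : env R -> int -> probability paths R) :
  annealed Pw P [set wx | walk_to_pinfty R wx.2] = 1%E ->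
  {ae P, forall w, Pw w 0 [set x | walk_to_pinfty R x] = 1%E}.
Proof.
rewrite /annealed => H; apply: ae_eq1_of_integral.
  by move=> w; rewrite measure_ge0/= probability_le1//;
    exact: measurable_walk_to_pinfty.
rewrite -[RHS]H; apply: eq_integral => w _; congr (Pw w 0 _).
by apply/seteqP; split=> x; rewrite /xsection /= inE.
Qed.

Definition elliptic (k : int) : set (env R) :=
  [set w | [/\ 0 < jq (w k), 0 < jp1 (w k) & 0 < jp2 (w k)]].

Lemma measurable_elliptic k : measurable (elliptic k).
Proof.
have m (f : jump_law R -> R) : (forall B, measurable B ->
    measurable [set w : env R | f (w k) \in B]) -> measurable [set w : env R | 0
      < f (w k)].
  move=> H; have := H _ (measurable_itv `]0, +oo[).
  congr measurable; apply/seteqP; split=> w /=; rewrite inE /= in_itv /= andbT//.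
rewrite (_ : elliptic k = [set w : env R | 0 < jq (w k)] `&`
   ([set w : env R | 0 < jp1 (w k)] `&` [set w : env R | 0 < jp2 (w k)])).
  apply: measurableI; [|apply: measurableI]; apply: m => B mB;
    apply: sub_sigma_algebra; exists k, B; split => //;
      [left|right;left|right;right]; by [].
by apply/seteqP; split=> w /=; [case|move=> [? [? ?]]].
Qed.

(** Ellipticity at 0 carries over to every site [k <= 0] by stationarity, and countably many almost
    sure events hold together. *)
Lemma elliptic_ae (P : probability (env R) R) eps : stationary P -> 0 < eps ->
  {ae P, forall w : env R,
     eps <= jp1 (w 0) / jq (w 0) /\ eps <= jp2 (w 0) / jq (w 0)} ->
  {ae P, forall w, forall k, k <= 0 -> elliptic k w}.
Proof.
move=> stat eps0 hell.
have e0 : P (elliptic 0) = 1%E.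
  have n0 : P.-negligible (~` elliptic 0).
    have FF := ae_filter_ringOfSetsType P.
    apply: filterS hell => w [h1 h2].
    (* Division by 0 yields 0 by convention, so [jq (w 0) = 0] would contradict the lower bound
       [eps > 0]. *)
    have q0 : 0 < jq (w 0).
      rewrite lt_neqAle jq_ge0 andbT eq_sym; apply: contraTN h1 => /eqP ->.
      by rewrite invr0 mulr0 -ltNge.
    by split=> //; rewrite -(pmulr_lgt0 _ (_ : 0 < (jq (w 0))^-1)) ?invr_gt0//; lra.
  have p0 := measure_negligible (measurableC (measurable_elliptic 0)) n0.
  rewrite -(setCK (elliptic 0)).
  apply: etrans (probability_setC P (measurableC (measurable_elliptic 0))) _.
  by rewrite [X in (_ - X)%E]p0 sube0.
have en n : P (elliptic (- n%:Z)) = 1%E.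
  (* The preimage under [shift] of ellipticity at [- n.+1] is ellipticity at [- n]. *)
  elim: n => [//|n IH]; rewrite -(stat _ (measurable_elliptic _)) -[RHS]IH.
  have -> : - n%:Z = - n.+1%:Z + 1 by lia.
  by [].
have : P.-negligible (\bigcup_n ~` elliptic (- n%:Z)).
  apply: negligible_bigcup => n; exists (~` elliptic (- n%:Z)); split=> //.
    by apply: measurableC; exact: measurable_elliptic.
  apply: etrans (probability_setC P (measurable_elliptic _)) _.
  by rewrite en subee.
apply: negligibleS => w /= /existsNP[k /not_implyP[k0 nk]]; exists `|k|%N => //.
by rewrite (_ : - `|k|%N%:Z = k)//; lia.
Qed.

End ae_facts.

Theorem corollary1p1 (R : realType) (P : probability (env R) R)
  (Pw : env R -> int -> probability paths R) (eps : R)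
  (hstat : stationary P) (herg : ergodic P)
  (heps : 0 < eps)
  (hell : {ae P, forall w : env R,
     eps <= jp1 (w 0) / jq (w 0) /\ eps <= jp2 (w 0) / jq (w 0)})
  (hPw : is_quenched Pw)
  (htrans : annealed Pw P [set wx | walk_to_pinfty R wx.2] = 1%E) :
  {ae P, forall w : env R,
    (forall i : int, i <= 0 ->
       offspring_mean (Pw w 0) i = map_mx EFin (Nmx Pw w i)) /\
    (\int[Pw w 0%R]_x T1 R x =
     1 + einner (row3 2 2 1)%R (erow_mul (immigrant_mean Pw w) (Nsum Pw w)))%E}.
Proof.
have FF := ae_filter_ringOfSetsType P.
apply: (filterS2 _ _ (elliptic_ae hstat heps hell) (pinfty_ae htrans)) => w pos_w inf_w.
have exits_w := exits_ae_of_pinfty inf_w.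
have q_gt0 k : k <= 0 -> 0 < jq (w k) by move=> /pos_w[].
have p1_gt0 k : k <= 0 -> 0 < jp1 (w k) by move=> /pos_w[].
have p2_gt0 k : k <= 0 -> 0 < jp2 (w k) by move=> /pos_w[].
split; first by move=> i; exact: (offspring_meanE (hPw w) q_gt0 p1_gt0 p2_gt0 exits_w).
exact: (integral_T1E (hPw w) p1_gt0 p2_gt0 exits_w).
Qed.
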